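(* Let $j\in\{0,\pm1,\pm2,\pm3,\pm4,\pm5\}$ and let $a,b,d,e$ be complex parameters such that $a$ or $d$ is a nonpositive integer (and such that the expressions below are defined, i.e. no denominator parameter is a nonpositive integer and the Gamma factors in the numerators are finite). Then $$ \begin{aligned} &\frac{\Gamma(e)\,\Gamma(e-2a-d)}{\Gamma(e-2a)\,\Gamma(e-d)}\;{}_3F_2\!\left[\begin{matrix}2a,\; b,\; d\\ 2b+j,\; 1+2a+d-e\end{matrix};\,2\right]\\ &=\frac{\Gamma(b)\,\Gamma(1-b)}{\Gamma\!\left(b+\tfrac12 j+\tfrac12|j|\right)\Gamma\!\left(1-b-\left[\tfrac{j+1}{2}\right]\right)} \sum_{n=0}^{\infty}\frac{A_j}{n!}\,\frac{(a)_n\left(a+\tfrac12\right)_n\left(b+\left[\tfrac{j+1}{2}\right]\right)_n}{\left(b+\tfrac12 j\right)_n\left(b+\tfrac12 j+\tfrac12\right)_n}\,\frac{\left(\tfrac12 d\right)_n\left(\tfrac12 d+\tfrac12\right)_n}{\left(\tfrac12 e\right)_n\left(\tfrac12 e+\tfrac12\right)_n}\\ &\quad+\frac{2a}{2b+j}\left(\frac{d}{e}\right)\frac{\Gamma(-b)\,\Gamma(1+b)}{\Gamma\!\left(b+\tfrac12 j+\tfrac12|j|\right)\Gamma\!\left(-b-\left[\tfrac{j}{2}\right]\right)} \sum_{n=0}^{\infty}\frac{B_j}{n!}\,\frac{\left(a+\tfrac12\right)_n(a+1)_n\left(b+1+\left[\tfrac{j}{2}\right]\right)_n}{\left(b+\tfrac12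 j+\tfrac12\right)_n\left(b+\tfrac12 j+1\right)_n}\,\frac{\left(\tfrac12 d+\tfrac12\right)_n\left(\tfrac12 d+1\right)_n}{\left(\tfrac12 e+\tfrac12\right)_n\left(\tfrac12 e+1\right)_n}, \end{aligned} $$ where the coefficients $A_j=A_j(n)$ and $B_j=B_j(n)$ (depending on $n$ and $b$) are as follows. - $A_5=-4(1-b-2n)^2+2(1-b)(1-b-2n)+(1-b)^2+22(1-b-2n)+13b-33$, $\;B_5=4(b+2n)^2-2(1-b)(b+2n)-(1-b)^2+34(b+2n)+b+61$. - $A_4=2(b+1+2n)(b+3+2n)-b(b+3)$, $\;B_4=4(b+3+2n)$. - $A_3=b+2+4n$, $\;B_3=-(3b+6+4n)$. - $A_2=-(b+1+2n)$, $\;B_2=-2$. - $A_1=-1$, $\;B_1=1$. - $A_0=1$, $\;B_0=0$. - $A_{-1}=1$, $\;B_{-1}=1$. - $A_{-2}=1-b-2n$, $\;B_{-2}=2$. - $A_{-3}=1-b-4n$, $\;B_{-3}=3-3b-4n$. - $A_{-4}=2(1-b-2n)(3-b-2n)-(1-b)(4-b)$, $\;B_{-4}=4(1-b-2n)$. - $A_{-5}=4(1-b-2n)^2-2(1-b)(1-b-2n)-(1-b)^2+8(1-b-2n)+7b-7$, $\;B_{-5}=4(b+2n)^2-2(1-b)(b+2n)-(1-b)^2-16(b+2n)+b-1$.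
   Context: $(x)_n=x(x+1)\cdots(x+n-1)$ with $(x)_0=1$ is the Pochhammer symbol. The generalized hypergeometric series is ${}_pF_q\left[\begin{matrix}\alpha_1,\dots,\alpha_p\\ \beta_1,\dots,\beta_q\end{matrix};z\right]=\sum_{n\ge0}\frac{(\alpha_1)_n\cdots(\alpha_p)_n}{(\beta_1)_n\cdots(\beta_q)_n}\frac{z^n}{n!}$, where no lower parameter $\beta_i$ is a nonpositive integer; if some upper parameter is a nonpositive integer the series is a finite sum. $[x]$ denotes the greatest integer less than or equal to $x$ (so e.g. $[-1/2]=-1$), $|j|$ is the absolute value, and $\Gamma$ is the Gamma function.
   Formalization: The constant term of B_{-5} is corrected from b-1 to b+11; with b-1 the identity fails, e.g. at j=-5, a=1, b=1/4, d=-1, e=1/2, where the left side is -31/9 but the right side is 295/63. *)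

(* Defs.v *)
From mathcomp Require Import all_boot all_order all_algebra.
From mathcomp Require Import complex.
From mathcomp Require Import all_classical all_reals all_analysis.

Set Implicit Arguments.
Unset Strict Implicit.
Unset Printing Implicit Defensive.

Import Order.TTheory GRing.Theory Num.Theory.
Import numFieldNormedType.Exports.

Local Open Scope ring_scope.
Local Open Scope complex_scope.
Local Open Scope classical_set_scope.

Section ComplexFunctions.
Variable R : realType.
Implicit Types (x : R) (z b : R[i]) (n : nat).

(* The carrier R[i]^o provides the topology of the modulus. *)
Definition csum (u : nat -> R[i]) : R[i] :=
  limn (series u : nat -> R[i]^o).

Definition pochhammer z n : R[i] := \prod_(0 <= k < n) (z + k%:R).

Definition pFq (al be : seq R[i]) z : R[i] :=
  csum (fun n => (\prod_(x <- al) pochhammer x n)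
               / (\prod_(y <- be) pochhammer y n) * (z ^+ n / n`!%:R)).

(* x to the complex power z, i.e. exp (z * ln x), for x > 0. *)
Definition rcpow x z : R[i] :=
  let: s +i* t := z in
  (x `^ s)%:C * (cos (t * ln x) +i* sin (t * ln x)).

(* Gauss' limit n! n^z / (z (z + 1) ... (z + n)).  At a pole of Gamma (a
   nonpositive integer z) the denominators eventually vanish, so that, since
   0^-1 = 0, Gamma z = 0 there and (Gamma z)^-1 is 0, the value at z of the
   entire function 1 / Gamma. *)
Definition Gamma z : R[i] :=
  limn ((fun n => n`!%:R * rcpow n%:R z / pochhammer z n.+1) : nat -> R[i]^o).

Definition nonposint z : Prop := exists n, z = - n%:R.

(* Negz k is the integer - (k + 1). *)
Definition Acoef (j : int) b (m : nat) : R[i] :=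
  let n : R[i] := m%:R in
  match j with
  | Posz 5 => - 4 * (1 - b - 2 * n) ^+ 2 + 2 * (1 - b) * (1 - b - 2 * n)
              + (1 - b) ^+ 2 + 22 * (1 - b - 2 * n) + 13 * b - 33
  | Posz 4 => 2 * (b + 1 + 2 * n) * (b + 3 + 2 * n) - b * (b + 3)
  | Posz 3 => b + 2 + 4 * n
  | Posz 2 => - (b + 1 + 2 * n)
  | Posz 1 => - 1
  | Posz 0 => 1
  | Negz 0 => 1
  | Negz 1 => 1 - b - 2 * n
  | Negz 2 => 1 - b - 4 * n
  | Negz 3 => 2 * (1 - b - 2 * n) * (3 - b - 2 * n) - (1 - b) * (4 - b)
  | Negz 4 => 4 * (1 - b - 2 * n) ^+ 2 - 2 * (1 - b) * (1 - b - 2 * n)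
              - (1 - b) ^+ 2 + 8 * (1 - b - 2 * n) + 7 * b - 7
  | _ => 0
  end.

(* In the published table the entry for j = - 5 ends in b - 1 instead of
   b + 11.  With b - 1 the identity fails: at a = 1, b = 1/4, d = - 1, e = 1/2
   its left-hand side is - 31/9, but its right-hand side would be 295/63. *)
Definition Bcoef (j : int) b (m : nat) : R[i] :=
  let n : R[i] := m%:R in
  match j with
  | Posz 5 => 4 * (b + 2 * n) ^+ 2 - 2 * (1 - b) * (b + 2 * n)
              - (1 - b) ^+ 2 + 34 * (b + 2 * n) + b + 61
  | Posz 4 => 4 * (b + 3 + 2 * n)
  | Posz 3 => - (3 * b + 6 + 4 * n)
  | Posz 2 => - 2
  | Posz 1 => 1
  | Posz 0 => 0
  | Negz 0 => 1
  | Negz 1 => 2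
  | Negz 2 => 3 - 3 * b - 4 * n
  | Negz 3 => 4 * (1 - b - 2 * n)
  | Negz 4 => 4 * (b + 2 * n) ^+ 2 - 2 * (1 - b) * (b + 2 * n)
              - (1 - b) ^+ 2 - 16 * (b + 2 * n) + b + 11
  | _ => 0
  end.

End ComplexFunctions.

Definition floor_half (k : int) : int := Num.floor (k%:~R / 2 : rat).

(* Main.v *)
Require Import Defs.
From mathcomp Require Import all_boot all_order all_algebra.
From mathcomp Require Import complex ring lra zify.
From mathcomp Require Import all_classical all_reals all_analysis.

(** The Chu-Vandermonde sum turns the terminating left-hand side into
[\sum_n (2a)_n (d)_n / ((e)_n n!) F_n] with [F_n = 2F1[-n, b; 2b+j; 2]].
The contiguous relation
[(2b+j+n+1) F_(n+2) = j F_(n+1) + (n+1) F_n] determines the [F_n], and for each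
[j] the closed forms with the coefficients [A_j] (even [n]) and [B_j] (odd [n])
satisfy it; splitting the sum by parity gives the two series on the right.
The Gamma quotients are Pochhammer quotients once Gauss' limit is known to
exist and to be nonzero, which holds since its successive ratios are
[1 + O(1/n^2)]. *)

Set Implicit Arguments.
Unset Strict Implicit.
Unset Printing Implicit Defensive.

Import Order.TTheory GRing.Theory Num.Theory.
Import numFieldNormedType.Exports.

Local Open Scope ring_scope.
Local Open Scope complex_scope.

(** * Pochhammer symbols and the terminating Gauss series at 2 *)

(** With [c = 2b + j] the middle coefficient [c - 2b] of the contiguous relation is [j]. For [j = 0]
    the even and odd [F_n] decouple and the odd ones vanish; for other [j] the two families feed
    each other, which is why two series appear. The coefficients [A_j], [B_j] are verified, not
    derived: once Pochhammer symbols are cancelled, only identities between polynomials in [m] with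
    coefficients rational in [b] remain, one set for each of the eleven [j]. Two degenerate
    situations shape the lemmas on Gamma and on infinite sums. One of [Gamma (e - 2a)],
    [Gamma (e - d)] may sit at a pole, so reciprocals of Gamma must be shifted there too. And for
    [a = 0] or [d = 0] the second series on the right need not break off; only its zero prefactor
    makes the product a finite sum. *)

Lemma pochhammer0 (R : realType) (z : R[i]) : pochhammer z 0 = 1.
Proof. by rewrite /pochhammer big_geq. Qed.

Lemma pochhammerSr (R : realType) (z : R[i]) n :
  pochhammer z n.+1 = pochhammer z n * (z + n%:R).
Proof. by rewrite /pochhammer big_nat_recr. Qed.

Lemma pochhammerD (R : realType) (z : R[i]) m n :
  pochhammer z (m + n) = pochhammer z m * pochhammer (z + m%:R) n.
Proof.
elim: n => [|n IHn]; first by rewrite addn0 pochhammer0 mulr1.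
by rewrite addnS !pochhammerSr IHn natrD -mulrA addrA.
Qed.

Lemma pochhammerSl (R : realType) (z : R[i]) n :
  pochhammer z n.+1 = z * pochhammer (z + 1) n.
Proof. by rewrite -add1n pochhammerD pochhammerSr pochhammer0 mul1r addr0. Qed.

Lemma pochhammer_neq0 (R : realType) (z : R[i]) n :
  ~ nonposint z -> pochhammer z n != 0.
Proof.
move=> hz; elim: n => [|n IHn]; first by rewrite pochhammer0 oner_neq0.
rewrite pochhammerSr mulf_neq0 //; apply/eqP => zn0; apply: hz; exists n.
by apply/eqP; rewrite -addr_eq0 zn0.
Qed.

Lemma pochhammer_eq0 (R : realType) m n :
  (m < n)%N -> pochhammer (- m%:R : R[i]) n = 0.
Proof.
move=> ltmn; rewrite -(subnKC ltmn) pochhammerD pochhammerSr.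
by rewrite addNr mulr0 mul0r.
Qed.

Lemma pochhammer_double (R : realType) (z : R[i]) n :
  pochhammer (2 * z) n.*2 = 4 ^+ n * (pochhammer z n * pochhammer (z + 1 / 2) n).
Proof.
elim: n => [|n IHn]; first by rewrite !pochhammer0 expr0 !mulr1.
rewrite doubleS !pochhammerSr IHn exprS -addn1 -muln2 natrD natrM.
by field.
Qed.

Lemma fact_double (R : realType) n :
  n.*2`!%:R = 4 ^+ n * (n`!%:R * pochhammer (1 / 2 : R[i]) n).
Proof.
elim: n => [|n IHn]; first by rewrite pochhammer0 expr0 !mulr1.
rewrite doubleS !factS !natrM IHn !pochhammerSr exprS -!(addn1 _.*2) -addn1 -muln2.
rewrite !natrD natrM.
by field.
Qed.

(** Pascal's rule turns the sum at [n + 1] into the sum at [n] minus [b / c] times the sum at [n]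
    with [b + 1], [c + 1]. This shift preserves [c - b], so both pieces have the same numerator by
    induction. *)
Lemma chu_vandermonde (R : realType) n (b c : R[i]) : ~ nonposint c ->
  \sum_(k < n.+1) (-1) ^+ k * 'C(n, k)%:R * (pochhammer b k / pochhammer c k)
  = pochhammer (c - b) n / pochhammer c n.
Proof.
elim: n b c => [|n IHn] b c hc.
  by rewrite big_ord1 !pochhammer0 bin0 expr0 !mul1r.
have hc1 : ~ nonposint (c + 1).
  by case=> m hm; apply: hc; exists m.+1; rewrite -natr1 opprD -hm addrK.
have c0 : c != 0.
  by have := pochhammer_neq0 1 hc; rewrite pochhammerSr pochhammer0 mul1r addr0.
transitivity (\sum_(k < n.+1) (-1) ^+ k * 'C(n, k)%:R
                  * (pochhammer b k / pochhammer c k)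
   - b / c * (\sum_(k < n.+1) (-1) ^+ k * 'C(n, k)%:R
                * (pochhammer (b + 1) k / pochhammer (c + 1) k))).
  rewrite big_ord_recl [in RHS]big_ord_recl.
  rewrite mulr_sumr -addrA; congr (_ + _); first by rewrite !bin0 !pochhammer0.
  rewrite (_ : \sum_(i < n) _ = \sum_(i < n.+1) (-1) ^+ (lift ord0 i)
      * 'C(n, lift ord0 i)%:R *
      (pochhammer b (lift ord0 i) / pochhammer c (lift ord0 i))); last first.
    by rewrite big_ord_recr /= bin_small // mulr0 mul0r addr0.
  rewrite -sumrN -big_split; apply: eq_bigr => k _ /=.
  rewrite /bump add1n binS natrD !pochhammerSl exprS.
  by rewrite invfM; ring.
rewrite IHn // IHn //.
have -> : c + 1 - (b + 1) = c - b by ring.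
have p0 := pochhammer_neq0 n hc; have p1 := pochhammer_neq0 n hc1.
have p2 := pochhammer_neq0 n.+1 hc.
have e2 : pochhammer c n.+1 = pochhammer c n * (c + n%:R).
  by rewrite pochhammerSr.
have e3 : c * pochhammer (c + 1) n = pochhammer c n * (c + n%:R).
  by rewrite -pochhammerSl.
have cn0 : c + n%:R != 0 by apply: contraNneq p2 => h; rewrite e2 h mulr0.
have -> : pochhammer (c + 1) n = pochhammer c n * (c + n%:R) / c.
  by rewrite -e3 mulrC mulKf.
rewrite !pochhammerSr; field.
by rewrite p0 c0 cn0.
Qed.

(* 2F1[-n, b; c; 2], since (-n)_k / k! = (-1)^k 'C(n, k). *)
Definition gauss2 (R : realType) (b c : R[i]) n : R[i] :=
  \sum_(k < n.+1) 'C(n, k)%:R * (-2) ^+ k * (pochhammer b k / pochhammer c k).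

(** A range independent of [n] is what allows consecutive values to be combined termwise and double
    sums to be exchanged. *)
Lemma gauss2_widen (R : realType) (b c : R[i]) n N : (n < N)%N ->
  gauss2 b c n = \sum_(k < N) 'C(n, k)%:R * (-2) ^+ k
                   * (pochhammer b k / pochhammer c k).
Proof.
move=> ltnN; rewrite /gauss2.
rewrite (big_ord_widen N (fun k => 'C(n, k)%:R * (-2) ^+ k
                             * (pochhammer b k / pochhammer c k))) //.
rewrite [RHS](bigID (fun k : 'I_N => (k < n.+1)%N)) /= [X in _ = _ + X]big1 ?addr0 //.
by move=> k; rewrite -leqNgt => /bin_small ->; rewrite !mul0r.
Qed.

(* Gauss' contiguous relation in the first parameter, at argument 2; in the
   proof, [g] is the telescoping certificate. *)
Lemma gauss2_rec (R : realType) (b c : R[i]) n : ~ nonposint c ->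
  (c + n.+1%:R) * gauss2 b c n.+2
  = (c - 2 * b) * gauss2 b c n.+1 + n.+1%:R * gauss2 b c n.
Proof.
move=> hc.
set x := fun k => (-2) ^+ k * (pochhammer b k / pochhammer c k) : R[i].
have xS k : (c + k%:R) * x k.+1 = - (2 * (b + k%:R) * x k).
  have := pochhammer_neq0 k.+1 hc; rewrite /x !pochhammerSr mulf_eq0 negb_or exprS.
  by move=> /andP[p0 p1]; field; rewrite p0 p1.
have E m : (m < n.+3)%N -> gauss2 b c m = \sum_(k < n.+3) 'C(m, k)%:R * x k.
  by move=> /gauss2_widen ->; apply: eq_bigr => k _; rewrite -mulrA.
apply/eqP; rewrite -subr_eq0; apply/eqP.
have ltn3 : (n < n.+3)%N by lia.
rewrite !E //.
rewrite opprD addrA !mulr_sumr -!sumrN -!big_split /=.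
pose g k := if k is l.+1 then 'C(n.+1, l)%:R * 2 * (b + l%:R) * x l else 0 : R[i].
rewrite (eq_bigr (fun k : 'I_n.+3 => g k.+1 - g k)); last first.
  move=> [k _] _ /=; case: k => [|k].
    by rewrite !bin0 subr0 -natr1; ring.
  (* The term ratio [xS] turns [x k] into [x k.+1], so every term now carries the factor [x k.+1]
     and the claim reduces to the binomial identities [h1], [h2], [h3]. *)
  have -> : g k.+1 = - ('C(n.+1, k)%:R * ((c + k%:R) * x k.+1)).
    by rewrite xS /=; ring.
  have h1 : (n.+1%:R * 'C(n, k)%:R : R[i]) = k.+1%:R * 'C(n.+1, k.+1)%:R.
    by rewrite -!natrM mul_bin_diag.
  have h2 : (n.+1%:R * 'C(n, k)%:R + k%:R * 'C(n.+1, k)%:R : R[i])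
            = n.+1%:R * 'C(n.+1, k)%:R.
    rewrite -!natrM -natrD; congr _%:R; case: k {h1} => [|k].
      by rewrite !bin0 mul0n addn0.
    by rewrite -mul_bin_diag -mulnDr -binS.
  have h3 : ('C(n, k.+1)%:R : R[i]) = 'C(n.+1, k.+1)%:R - 'C(n, k)%:R.
    by rewrite [in RHS]binS natrD addrK.
  rewrite [in 'C(n.+2, _)]binS natrD /= h3.
  move: h1 h2; set X := x k.+1; set C1 := 'C(n.+1, k.+1)%:R.
  set C0 := 'C(n.+1, k)%:R; set C := 'C(n, k)%:R => h1 h2.
  transitivity ((2 * (b + k.+1%:R) * C1 + (c + k%:R) * C0) * X
     + ((n.+1%:R * C0 - (n.+1%:R * C + k%:R * C0)) + 2 * (n.+1%:R * C - k.+1%:R * C1)) * X).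
    by ring.
  by rewrite h2 h1 !subrr mulr0 addr0 mul0r addr0 -!natr1; ring.
rewrite -(big_mkord xpredT (fun k => g k.+1 - g k)) telescope_sumr //=.
by rewrite bin_small //; ring.
Qed.

Lemma gauss2_0 (R : realType) (b c : R[i]) : gauss2 b c 0 = 1.
Proof. by rewrite /gauss2 big_ord1 !pochhammer0 bin0 expr0 !mul1r invr1. Qed.

Lemma nonposintD (R : realType) (z : R[i]) n :
  ~ nonposint z -> ~ nonposint (z + n%:R).
Proof.
by move=> hz [m hm]; apply: hz; exists (m + n)%N; rewrite natrD opprD -hm addrK.
Qed.

Lemma nonposint_neq0 (R : realType) (z : R[i]) : ~ nonposint z -> z != 0.
Proof. by move=> hz; apply/eqP => z0; apply: hz; exists 0%N; rewrite oppr0. Qed.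

Lemma gauss2_1 (R : realType) (b c : R[i]) : ~ nonposint c ->
  c * gauss2 b c 1 = c - 2 * b.
Proof.
move=> /nonposint_neq0 c0.
rewrite /gauss2 !big_ord_recl big_ord0 /= !pochhammerSr !pochhammer0 /bump /=.
by rewrite bin0 binn expr0; field.
Qed.

(** The leading coefficient [c + n + 1] never vanishes, so a solution of the recurrence is
    determined by its first two values; [E] and [O] are the candidate even and odd halves, and the
    two hypotheses are the recurrence at even and at odd index. *)
Lemma gauss2_even_odd (R : realType) (b c : R[i]) (E O : nat -> R[i]) :
  ~ nonposint c -> E 0 = 1 -> c * O 0 = c - 2 * b ->
  (forall m, (c + m.*2.+1%:R) * E m.+1
             = (c - 2 * b) * O m + m.*2.+1%:R * E m) ->
  (forall m, (c + m.*2.+2%:R) * O m.+1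
             = (c - 2 * b) * E m.+1 + m.*2.+2%:R * O m) ->
  forall m, gauss2 b c m.*2 = E m /\ gauss2 b c m.*2.+1 = O m.
Proof.
move=> hc E0 O0 hE hO.
have c_neq0 n : c + n%:R != 0 by exact/nonposint_neq0/nonposintD.
elim=> [|m [IHE IHO]].
  rewrite gauss2_0 E0; split=> //; apply: (mulfI (nonposint_neq0 hc)).
  by rewrite gauss2_1.
have hEm : gauss2 b c m.+1.*2 = E m.+1.
  by apply: (mulfI (c_neq0 m.*2.+1)); rewrite hE gauss2_rec // IHE IHO.
split=> //; apply: (mulfI (c_neq0 m.*2.+2)).
by rewrite hO -hEm -IHO gauss2_rec.
Qed.

Lemma pochhammer_shift (R : realType) (z : R[i]) n : z != 0 ->
  pochhammer (z + 1) n = pochhammer z n * (z + n%:R) / z.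
Proof. by move=> z0; rewrite -pochhammerSr pochhammerSl mulrC mulKf. Qed.

Lemma double1R (F : pzSemiRingType) m : m.*2.+1%:R = 2 * m%:R + 1 :> F.
Proof. by rewrite -natr1 -mul2n natrM. Qed.

(* The case [j] even of the theorem: [h = b + j / 2] differs from [b] by an
   integer, so that the Pochhammer symbols of [b + [(j + 1) / 2]] and of [h]
   cancel. *)
Lemma gauss2_even_shift (R : realType) (b h : R[i]) (A B : nat -> R[i]) :
  ~ nonposint (2 * h) -> ~ nonposint (h + 1 / 2) ->
  A 0 = 1 -> B 0 = 2 * h - 2 * b ->
  (forall m, 2 * h * A m.+1 = (2 * h - 2 * b) * B m + 2 * h * A m) ->
  (forall m, (2 * h + m.*2.+2%:R) * m.*2.+3%:R * B m.+1
     = (2 * h - 2 * b) * (2 * h) * A m.+1 + m.*2.+2%:R * (2 * h + m.*2.+1%:R) * B m) ->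
  forall m,
    gauss2 b (2 * h) m.*2
      = A m * pochhammer (1 / 2) m / pochhammer (h + 1 / 2) m /\
    gauss2 b (2 * h) m.*2.+1
      = B m / (2 * h) * pochhammer (1 / 2 + 1) m / pochhammer (h + 1 / 2) m.
Proof.
move=> h2 hh A0 B0 hA hB.
have h0 := nonposint_neq0 h2.
have hn0 : h != 0 by apply: contraNneq h0 => ->; rewrite mulr0.
have half0 : (1 / 2 : R[i]) != 0 by rewrite mul1r invr_eq0 pnatr_eq0.
apply: gauss2_even_odd => //.
- by rewrite A0 !pochhammer0 divr1 mulr1.
- by rewrite !pochhammer0 divr1 mulr1 mulrC divfK.
- move=> m; have := pochhammer_neq0 m.+1 hh.
  rewrite pochhammerSr mulf_eq0 negb_or => /andP[p0 p1].
  have p1' : h * 2 + 1 + m%:R * 2 != 0.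
    apply: contraNneq p1 => p10.
    have -> : h + 1 / 2 + m%:R = (h * 2 + 1 + m%:R * 2) / 2 by field.
    by rewrite p10 mul0r.
  rewrite !pochhammer_shift // !pochhammerSr.
  have -> : A m.+1 = (2 * h - 2 * b) * B m / (2 * h) + A m.
    by apply: (mulfI h0); rewrite hA; field; rewrite ?hn0.
  rewrite double1R; field.
  by rewrite p0 hn0 p1'.
- move=> m; have := pochhammer_neq0 m.+1 hh.
  rewrite pochhammerSr mulf_eq0 negb_or => /andP[p0 p1].
  have p1' : h * 2 + 1 + m%:R * 2 != 0.
    apply: contraNneq p1 => p10.
    have -> : h + 1 / 2 + m%:R = (h * 2 + 1 + m%:R * 2) / 2 by field.
    by rewrite p10 mul0r.
  have d0 : 2 * h + m.*2.+2%:R != 0 by exact/nonposint_neq0/nonposintD.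
  have d1 : m.*2.+3%:R != 0 :> R[i] by rewrite pnatr_eq0.
  rewrite !pochhammer_shift // !pochhammerSr.
  have -> : B m.+1 = ((2 * h - 2 * b) * (2 * h) * A m.+1
                      + m.*2.+2%:R * (2 * h + m.*2.+1%:R) * B m)
                     / ((2 * h + m.*2.+2%:R) * m.*2.+3%:R).
    by apply: (mulfI (mulf_neq0 d0 d1)); rewrite hB [RHS]mulrC divfK ?mulf_neq0.
  move: d0 d1; rewrite -![m.*2.+3%:R]natr1 -[m.*2.+2%:R]natr1 double1R.
  rewrite -[m.+1%:R]natr1 => d0 d1; field.
  by rewrite p0 hn0 p1' d1 d0.
Qed.

(* The case [j] odd: here the Pochhammer symbols of [h + 1 / 2] cancel. *)
Lemma gauss2_odd_shift (R : realType) (b h : R[i]) (A B : nat -> R[i]) :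
  ~ nonposint h -> ~ nonposint (2 * h) ->
  A 0 = 1 -> B 0 = 2 * h - 2 * b ->
  (forall m, (2 * h + m.*2.+1%:R) * A m.+1
     = (2 * h - 2 * b) * B m + (2 * h + m.*2%:R) * A m) ->
  (forall m, m.*2.+3%:R * B m.+1
     = (2 * h - 2 * b) * A m.+1 + m.*2.+2%:R * B m) ->
  forall m,
    gauss2 b (2 * h) m.*2 = A m * pochhammer (1 / 2) m / pochhammer h m /\
    gauss2 b (2 * h) m.*2.+1
      = B m / (2 * h) * pochhammer (1 / 2 + 1) m / pochhammer (h + 1) m.
Proof.
move=> hh h2 A0 B0 hA hB.
have h20 := nonposint_neq0 h2.
have h0 := nonposint_neq0 hh.
have half0 : (1 / 2 : R[i]) != 0 by rewrite mul1r invr_eq0 pnatr_eq0.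
apply: gauss2_even_odd => //.
- by rewrite A0 !pochhammer0 divr1 mulr1.
- by rewrite !pochhammer0 divr1 mulr1 mulrC divfK.
- move=> m; have := pochhammer_neq0 m.+1 hh.
  rewrite pochhammerSr mulf_eq0 negb_or => /andP[p0 p1].
  have d0 : 2 * h + m.*2.+1%:R != 0 by exact/nonposint_neq0/nonposintD.
  rewrite !pochhammer_shift // !pochhammerSr.
  have -> : A m.+1 = ((2 * h - 2 * b) * B m + (2 * h + m.*2%:R) * A m)
                     / (2 * h + m.*2.+1%:R).
    by apply: (mulfI d0); rewrite hA [RHS]mulrC divfK.
  move: d0; rewrite double1R -mul2n natrM => d0; field.
  by rewrite p0 h0 p1 d0.
- move=> m; have := pochhammer_neq0 m.+1 hh.
  rewrite pochhammerSr mulf_eq0 negb_or => /andP[p0 p1].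
  have d0 : h + m.+1%:R != 0 by exact/nonposint_neq0/nonposintD.
  have d1 : m.*2.+3%:R != 0 :> R[i] by rewrite pnatr_eq0.
  rewrite !pochhammer_shift // !pochhammerSr.
  have -> : B m.+1 = ((2 * h - 2 * b) * A m.+1 + m.*2.+2%:R * B m) / m.*2.+3%:R.
    by apply: (mulfI d1); rewrite hB [RHS]mulrC divfK.
  move: d0 d1; rewrite -![m.*2.+3%:R]natr1 -[m.*2.+2%:R]natr1 double1R.
  rewrite -[m.+1%:R]natr1 => d0 d1; field.
  by rewrite p0 h0 p1 d0 d1.
Qed.

(** * Expansion of the terminating 3F2 in Gauss series *)

Lemma pochhammer_opp_nat (R : realType) n m :
  pochhammer (- n%:R : R[i]) m = (-1) ^+ m * (m`!%:R * 'C(n, m)%:R).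
Proof.
rewrite -natrM mulnC bin_ffact.
elim: m => [|m IHm]; first by rewrite pochhammer0 ffactn0 expr0 mul1r.
rewrite pochhammerSr IHm ffactnSr exprS natrM.
have [lemn | ltnm] := leqP m n; first by rewrite natrB //; ring.
by rewrite ffact_small // !mul0r !mulr0 mul0r.
Qed.

(** The factors on the left are those of [pochhammer z n], negated and in reverse order. *)
Lemma pochhammer_reflect (R : realType) (z : R[i]) n :
  pochhammer (1 - z - n%:R) n = (-1) ^+ n * pochhammer z n.
Proof.
elim: n => [|n IHn]; first by rewrite !pochhammer0 expr0 mul1r.
rewrite pochhammerSl (_ : 1 - z - n.+1%:R + 1 = 1 - z - n%:R); last first.
  by rewrite -natr1; ring.
by rewrite IHn pochhammerSr exprS -natr1; ring.
Qed.

(** The binomial kills the terms [n < k]. After [n = m + k] each symbol loses its first [k] factors,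
    and what remains is Chu-Vandermonde at [M - k] with parameters [y + k] and [e + k], whose
    difference [e - y] does not depend on [k]. *)
Lemma sum_bin_pochhammer (R : realType) M k (y e : R[i]) :
  (k <= M)%N -> ~ nonposint e ->
  \sum_(n < M.+1) 'C(n, k)%:R * (pochhammer (- M%:R) n * pochhammer y n
                                 / (pochhammer e n * n`!%:R))
  = pochhammer (- M%:R) k * pochhammer y k / k`!%:R
    * (pochhammer (e - y) (M - k) / pochhammer e M).
Proof.
move=> lekM he.
have fact0 n : (n`!%:R : R[i]) != 0 by rewrite pnatr_eq0 -lt0n fact_gt0.
pose F n : R[i] := 'C(n, k)%:R * (pochhammer (- M%:R) n * pochhammer y n
                                 / (pochhammer e n * n`!%:R)).
rewrite -(big_mkord xpredT F) (big_cat_nat (n := k)) ?(leqW lekM) //=.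
rewrite big_nat big1 ?add0r; last first.
  by move=> n /andP[_ ltnk]; rewrite /F bin_small // mul0r.
rewrite -{1}[k]add0n big_addn subSn // big_mkord.
have ek : ~ nonposint (e + k%:R) by exact: nonposintD.
have Ek : e + k%:R - (y + k%:R) = e - y by ring.
transitivity (pochhammer (- M%:R) k * pochhammer y k / (pochhammer e k * k`!%:R)
  * (pochhammer (e + k%:R - (y + k%:R)) (M - k) / pochhammer (e + k%:R) (M - k))).
  rewrite -chu_vandermonde // mulr_sumr; apply: eq_bigr => m _.
  rewrite /F addnC !pochhammerD.
  have -> : - M%:R + k%:R = - (M - k)%:R :> R[i].
    by rewrite natrB // opprB addrC.
  rewrite (pochhammer_opp_nat _ (M - k)).
  have := bin_fact (leq_addr m k); rewrite addKn => /(congr1 (fun n => n%:R : R[i])).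
  rewrite !natrM => <-.
  have := pochhammer_neq0 k he; have := pochhammer_neq0 m ek.
  have c0 : ('C(k + m, k)%:R : R[i]) != 0.
    by rewrite pnatr_eq0 -lt0n bin_gt0 leq_addr.
  by move=> p0 p1; field; rewrite p0 p1 c0 !fact0.
have -> : pochhammer e M = pochhammer e k * pochhammer (e + k%:R) (M - k).
  by rewrite -pochhammerD subnKC.
rewrite Ek.
have := pochhammer_neq0 k he; have := pochhammer_neq0 (M - k) ek.
by move=> p0 p1; field; rewrite p0 p1 !fact0.
Qed.

(** The first [M - k] factors of [(e - y)_M] are the numerator of [sum_bin_pochhammer]; the last
    [k], reversed, are up to sign the lower parameter's symbol [(1 - M + y - e)_k], which cancels.
    The sign turns [2 ^+ k] into [(-2) ^+ k], and exchanging the sums collects the Gauss series. *)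
Lemma terminating_3F2 (R : realType) M (b c y e : R[i]) :
  ~ nonposint c -> ~ nonposint e -> ~ nonposint (1 - M%:R + y - e) ->
  pochhammer (e - y) M / pochhammer e M
  * (\sum_(k < M.+1) pochhammer (- M%:R) k * pochhammer b k * pochhammer y k
      / (pochhammer c k * pochhammer (1 - M%:R + y - e) k) * (2 ^+ k / k`!%:R))
  = \sum_(n < M.+1) pochhammer (- M%:R) n * pochhammer y n
      / (pochhammer e n * n`!%:R) * gauss2 b c n.
Proof.
move=> hc he hf.
have fact0 n : (n`!%:R : R[i]) != 0 by rewrite pnatr_eq0 -lt0n fact_gt0.
transitivity (\sum_(k < M.+1) (-2) ^+ k * (pochhammer b k / pochhammer c k) *
  \sum_(n < M.+1) 'C(n, k)%:R * (pochhammer (- M%:R) n * pochhammer y n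
                                 / (pochhammer e n * n`!%:R))).
  rewrite mulr_sumr; apply: eq_bigr => -[k ltkM] _ /=.
  rewrite sum_bin_pochhammer //.
  have -> : pochhammer (e - y) M = pochhammer (e - y) (M - k) *
      ((-1) ^+ k * pochhammer (1 - M%:R + y - e) k).
    rewrite -{1}(subnK (_ : (k <= M)%N)) // pochhammerD; congr (_ * _).
    rewrite natrB // -[LHS](signrMK k) -pochhammer_reflect.
    by congr (_ * pochhammer _ _); ring.
  have := pochhammer_neq0 k hc; have := pochhammer_neq0 M he.
  have := pochhammer_neq0 k hf.
  rewrite -[- 2]mulN1r exprMn.
  by move=> p0 p1 p2; field; rewrite p0 p1 p2 fact0.
under eq_bigr do rewrite mulr_sumr.
rewrite exchange_big /=; apply: eq_bigr => n _.
rewrite (gauss2_widen b c (ltn_ord n)) mulr_sumr; apply: eq_bigr => k _.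
by ring.
Qed.

(** * Series that reduce to finite sums *)

Lemma csum_finite (R : realType) (u : nat -> R[i]) N :
  (forall k, (N <= k)%N -> u k = 0) -> csum u = \sum_(k < N) u k.
Proof.
move=> u0; rewrite /csum; apply: (lim_near_cst (@norm_hausdorff _ (R[i]^o))).
exists N => // n /= leNn.
rewrite /series /= -(big_mkord xpredT u) (big_cat_nat (leq0n N) leNn) //=.
by rewrite [X in _ + X]big_nat [X in _ + X]big1 ?addr0 // => k /andP[/u0].
Qed.

(** Vanishing is required of [p * u k] only: when [p = 0] the sequence [u] may have infinitely many
    nonzero terms, and whatever value [csum] takes is annihilated. *)
Lemma mulr_csum_finite (R : realType) (p : R[i]) (u : nat -> R[i]) N :
  (forall k, (N <= k)%N -> p * u k = 0) -> p * csum u = \sum_(k < N) p * u k.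
Proof.
have [-> _ | p0 pu0] := eqVneq p 0.
  by rewrite mul0r big1 // => k _; rewrite mul0r.
rewrite (@csum_finite _ _ N) ?mulr_sumr // => k /pu0 /eqP.
by rewrite mulf_eq0 (negbTE p0) => /eqP.
Qed.

Lemma sum_even_odd (V : zmodType) (u : nat -> V) N :
  \sum_(n < N.*2) u n = \sum_(m < N) u m.*2 + \sum_(m < N) u m.*2.+1.
Proof.
elim: N => [|N IHN]; first by rewrite !big_ord0 addr0.
by rewrite doubleS !big_ord_recr /= IHN -!addrA; congr (_ + _); rewrite addrCA.
Qed.

(** * Estimates for the exponential *)

(** Applied three times below, each bound feeding the next: the bound 1 on [cos] controls [sin x],
    this controls [cos x - 1], and this controls [sin x - x]. *)
Lemma MVT0 (R : realType) (f df : R -> R) x :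
  (forall y, is_derive y (1 : R) f (df y)) ->
  exists2 c, `|c| <= `|x| & f x - f 0 = df c * x.
Proof.
move=> fdf.
have fc a b : {within `[a, b], continuous f}%classic.
  by apply: derivable_within_continuous => y _; exact: ex_derive.
have [x0 | x0] := leP 0 x.
  have [c] := MVT_segment x0 (fun y _ => fdf y) (fc 0 x).
  rewrite in_itv /= subr0 => /andP[c0 cx] ->; exists c => //.
  by rewrite !ger0_norm.
have [c] := MVT_segment (ltW x0) (fun y _ => fdf y) (fc x 0).
rewrite in_itv /= => /andP[xc c0] e; exists c.
  by rewrite (ler0_norm c0) (ltr0_norm x0) lerN2.
by rewrite -opprB e sub0r mulrN opprK.
Qed.

Lemma norm_sin_le (R : realType) (x : R) : `|sin x| <= `|x|.
Proof.
have [c _] := MVT0 x (@is_derive_sin R).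
rewrite sin0 subr0 => ->; rewrite normrM ler_piMl // ler_norml.
by rewrite cos_geN1 cos_le1.
Qed.

Lemma norm_cos_sub1_le (R : realType) (x : R) : `|cos x - 1| <= x ^+ 2.
Proof.
have [c cx] := MVT0 x (@is_derive_cos R).
rewrite cos0 => ->; rewrite normrM normrN -real_normK ?num_real // expr2.
by rewrite ler_wpM2r // (le_trans (norm_sin_le c)).
Qed.

Lemma norm_sin_sub_le (R : realType) (x : R) : `|x| <= 1 -> `|sin x - x| <= x ^+ 2.
Proof.
move=> x1.
have df y : is_derive y (1 : R) (fun y : R => sin y - y) (cos y - 1).
  by exact: is_deriveB.
have [c cx] := MVT0 x df.
rewrite sin0 !subr0 => ->; rewrite normrM -[x ^+ 2]real_normK ?num_real // expr2.
rewrite ler_wpM2r // (le_trans (norm_cos_sub1_le c)) //.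
rewrite -[c ^+ 2]real_normK ?num_real // expr2.
by rewrite (le_trans _ cx) // ler_piMl // (le_trans cx).
Qed.

(** Both sides come from [1 + t <= expR t]: at [x] it gives the lower bound, at [- x] it gives
    [expR x <= 1 / (1 - x)], which exceeds [1 + x] by [x ^+ 2 / (1 - x) <= 2 * x ^+ 2]. *)
Lemma expR_approx (R : realType) (x : R) : `|x| <= 1 / 2 ->
  `|expR x - 1 - x| <= 2 * x ^+ 2.
Proof.
rewrite ler_norml => /andP[x1 x2].
have h1 := expR_ge1Dx x; have h2 := expR_ge1Dx (- x).
have h3 : expR x * (1 - x) <= 1.
  by rewrite -[leRHS](expRxMexpNx_1 x) ler_wpM2l ?expR_ge0.
by rewrite ler_norml; nra.
Qed.

Lemma expR_le2 (R : realType) (x : R) : `|x| <= 1 / 2 -> expR x <= 2.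
Proof.
move=> x1; have := expR_approx x1; move: x1.
by rewrite !ler_norml => /andP[x1 x2] /andP[_ h]; nra.
Qed.

Lemma normc_le (R : realType) (x y : R) : `|x +i* y| <= (`|x| + `|y|)%:C.
Proof.
rewrite normc_def lecR /= -[leRHS]ger0_norm ?addr_ge0 // -sqrtr_sqr.
rewrite ler_sqrt ?sqr_ge0 // sqrrD !real_normK ?num_real //.
by rewrite addrAC lerDl mulrn_wge0 // mulr_ge0.
Qed.

(* exp (z * u) *)
Definition cexp (R : realType) (z : R[i]) (u : R) : R[i] :=
  (expR (complex.Re z * u))%:C * (cos (complex.Im z * u) +i* sin (complex.Im z * u)).

Lemma cexpD (R : realType) (z : R[i]) (u v : R) :
  cexp z (u + v) = cexp z u * cexp z v.
Proof.
rewrite /cexp !mulrDr expRD cosD sinD.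
by apply/eqP; rewrite eq_complex /=; apply/andP; split; apply/eqP; ring.
Qed.

Lemma cexp0 (R : realType) (z : R[i]) : cexp z 0 = 1.
Proof.
rewrite /cexp !mulr0 expR0 cos0 sin0.
by apply/eqP; rewrite eq_complex /= !mulr0 !mul0r mul1r subr0 addr0 !eqxx.
Qed.

Lemma cexp_neq0 (R : realType) (z : R[i]) (u : R) : cexp z u != 0.
Proof.
apply/eqP => u0; have /eqP := cexpD z u (- u).
by rewrite subrr cexp0 u0 mul0r oner_eq0.
Qed.

Lemma rcpowE (R : realType) (x : R) (z : R[i]) : 0 < x -> rcpow x z = cexp z (ln x).
Proof. by move=> x0; case: z => s t; rewrite /rcpow /cexp /powR gt_eqF. Qed.

Lemma cexp_add1 (R : realType) (x : R) (z : R[i]) : 0 < x ->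
  cexp (z + 1) (ln x) = x%:C * cexp z (ln x).
Proof.
move=> x0; case: z => s t; rewrite /cexp /= addr0 mulrDl mul1r expRD lnK //.
by rewrite rmorphM /= [_ * x%:C]mulrC mulrA.
Qed.

(** The linear term is taken at [v] instead of [u] with a view to [u = ln ((n + 1) / n)] and
    [v = 1 / (n + 1)], where it will cancel exactly; [d] absorbs the discrepancy. *)
Lemma cexp_approx (R : realType) (z : R[i]) (u v d : R) :
  `|complex.Re z * u| <= 1 / 2 -> `|complex.Im z * u| <= 1 -> `|u - v| <= d ->
  `|cexp z u - 1 - z * v%:C|
    <= (5 * (complex.Re z ^+ 2 + complex.Im z ^+ 2) * u ^+ 2
        + (`|complex.Re z| + `|complex.Im z|) * d)%:C.
Proof.
case: z => s t /= su tu uvd.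
have -> : cexp (s +i* t) u - 1 - (s +i* t) * v%:C
  = (expR (s * u) * cos (t * u) - 1 - s * v)
    +i* (expR (s * u) * sin (t * u) - t * v).
  by apply/eqP; rewrite eq_complex /=; apply/andP; split; apply/eqP; ring.
apply: (le_trans (normc_le _ _)); rewrite lecR.
have := norm_cos_sub1_le (t * u); have := norm_sin_sub_le tu.
have := expR_approx su; have := expR_le2 su; have := expR_ge0 (s * u).
set E := expR _; set c := cos _; set si := sin _ => E0 E2 hE hs hc.
have -> : E * c - 1 - s * v = E * (c - 1) + (E - 1 - s * u) + s * (u - v).
  by ring.
have -> : E * si - t * v
  = E * (si - t * u) + (E - 1 - s * u) * (t * u) + (s * u) * (t * u) + t * (u - v).
  by ring.
have h1 : `|E * (c - 1)| <= 2 * (t * u) ^+ 2.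
  by rewrite normrM (ger0_norm E0) ler_pM.
have h2 : `|E * (si - t * u)| <= 2 * (t * u) ^+ 2.
  by rewrite normrM (ger0_norm E0) ler_pM.
have h3 w : `|w * (u - v)| <= `|w| * d by rewrite normrM ler_wpM2l.
have h4 : `|(E - 1 - s * u) * (t * u)| <= 2 * (s * u) ^+ 2.
  rewrite normrM; apply: (le_trans (ler_pM _ _ hE tu)) => //.
  by rewrite mulr1.
have h5 : `|(s * u) * (t * u)| <= ((s * u) ^+ 2 + (t * u) ^+ 2) / 2.
  rewrite ler_norml; have := sqr_ge0 (s * u + t * u); have := sqr_ge0 (s * u - t * u).
  by nra.
apply: (le_trans (lerD (ler_normD _ _) (ler_normD _ _))).
have h6 := ler_normD (E * (c - 1)) (E - 1 - s * u).
have h7 := ler_normD (E * (si - t * u) + (E - 1 - s * u) * (t * u)) (s * u * (t * u)).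
have h8 := ler_normD (E * (si - t * u)) ((E - 1 - s * u) * (t * u)).
have := h3 s; have := h3 t.
move: h6 h7 h8 h1 h2 h4 h5 hE.
rewrite !exprMn; set s2 := s ^+ 2 * u ^+ 2; set t2 := t ^+ 2 * u ^+ 2.
(* The quadratic errors of the real and imaginary parts add up to 9/2 times [s2 + t2], rounded up to
   5. *)
have -> : 5 * (s ^+ 2 + t ^+ 2) * u ^+ 2 = 5 * s2 + 5 * t2.
  by rewrite /s2 /t2; ring.
have : 0 <= s2 by rewrite mulr_ge0 ?sqr_ge0.
have : 0 <= t2 by rewrite mulr_ge0 ?sqr_ge0.
rewrite mulrDl; clear; lra.
Qed.

(** * Convergence of Gauss' limit *)

(* The bound on the successive ratios is O(1/n^2), written so as to telescope. *)
Lemma ratio_dist_le (F : numFieldType) (f : nat -> F) (C : F) m :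
  (0 < m)%N -> 0 <= C -> 4 * C <= m%:R ->
  (forall n, (m <= n)%N -> `|f n.+1 - f n| <= `|f n| * (C * (n%:R^-1 - n.+1%:R^-1))) ->
  forall n, (m <= n)%N -> `|f n - f m| <= `|f m| * (2 * C * (m%:R^-1 - n%:R^-1)).
Proof.
move=> m0 C0 Cm hf n lemn; rewrite -(subnKC lemn); elim: (n - m)%N => [|k IHk].
  by rewrite addn0 !subrr normr0 !mulr0.
set p := (m + k)%N in IHk *; rewrite addnS -/p.
have lemp : (m <= p)%N by exact: leq_addr.
have p0 : (0 < p)%N by exact: leq_trans lemp.
(* The induction hypothesis and [2 * C / m <= 1] keep [f p] within [|f m|] of [f m]. This doubling
   is the factor 2 in front of [C] in the conclusion. *)
have fp : `|f p| <= `|f m| * 2.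
  rewrite -[f p](subrK (f m)) (le_trans (ler_normD _ _)) //.
  rewrite (_ : `|f m| * 2 = `|f m| * 1 + `|f m|); last by ring.
  rewrite lerD2r (le_trans IHk) // ler_wpM2l //.
  rewrite (@le_trans _ _ (2 * C * m%:R^-1)) //.
    by rewrite ler_wpM2l ?mulr_ge0 // gerBl invr_ge0.
  rewrite ler_pdivrMr ?ltr0n // mul1r (le_trans _ Cm) //.
  by rewrite ler_wpM2r // ler_nat.
have -> : f p.+1 - f m = (f p.+1 - f p) + (f p - f m) by ring.
rewrite (le_trans (ler_normD _ _)) //.
have -> : `|f m| * (2 * C * (m%:R^-1 - p.+1%:R^-1))
  = `|f m| * 2 * (C * (p%:R^-1 - p.+1%:R^-1)) + `|f m| * (2 * C * (m%:R^-1 - p%:R^-1)).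
  by ring.
rewrite lerD // (le_trans (hf _ lemp)) // ler_wpM2r // mulr_ge0 // subr_ge0.
by rewrite lef_pV2 ?posrE ?ltr0n // ler_nat.
Qed.

Lemma real_cvg_dist (R : realType) (u : nat -> R) (D : R) m0 :
  (forall m n, (m0 <= m)%N -> (m <= n)%N -> `|u n - u m| <= D / m%:R) ->
  exists l : R, (u @ \oo --> l)%classic.
Proof.
move=> hu; suff : cvg (u @ \oo)%classic by move=> ul; exists (lim (u @ \oo)%classic).
apply/cauchy_cvgP/cauchy_exP => e e0.
pose m := (m0 + (Num.truncn (`|D| / e)).+1)%N.
exists (u m); exists m => // n /= lemn; rewrite /ball /= distrC.
apply: (le_lt_trans (hu _ _ (leq_addr _ _) lemn)).
have m_gt : `|D| / e < m%:R.
  rewrite (lt_le_trans (truncnS_gt _)) // ler_nat leq_addl //.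
have mp : 0 < m%:R :> R by rewrite ltr0n /m addnS.
rewrite ltr_pdivrMr // mulrC (le_lt_trans (ler_norm D)) //.
by rewrite -ltr_pdivrMr.
Qed.

Lemma complex_cvg (R : realType) (f : nat -> R[i]) (x y : R) :
  ((fun n => complex.Re (f n)) @ \oo --> x)%classic ->
  ((fun n => complex.Im (f n)) @ \oo --> y)%classic ->
  ((f : nat -> R[i]^o) @ \oo --> (x +i* y : R[i]^o))%classic.
Proof.
move=> /cvgrPdist_lt fx /cvgrPdist_lt fy; apply/cvgrPdist_lt => -[e e'].
rewrite ltcE /= => /andP[/eqP -> e0].
have e2 : 0 < e / 2 by rewrite divr_gt0.
near=> n.
have -> : (x +i* y : R[i]) - f n = (x - complex.Re (f n)) +i* (y - complex.Im (f n)).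
  by case: (f n).
apply: (le_lt_trans (normc_le _ _)); rewrite -[X in _ < X]/(e%:C) ltcR.
rewrite (splitr e) ltrD //.
- by near: n; exact: fx.
- by near: n; exact: fy.
Unshelve. all: by end_near. Qed.

Lemma normc_real (R : realType) (z : R[i]) : `|z| = (complex.Re `|z|)%:C.
Proof. by rewrite normc_def. Qed.

Lemma norm_Re_le (R : realType) (z : R[i]) (x : R) : `|z| <= x%:C -> `|complex.Re z| <= x.
Proof. by move=> /(le_trans (normc_ge_Re z)); rewrite lecR. Qed.

Lemma norm_Im_le (R : realType) (z : R[i]) (x : R) : `|z| <= x%:C -> `|complex.Im z| <= x.
Proof.
rewrite normc_def lecR; apply: le_trans.
by rewrite -sqrtr_sqr ler_sqrt ?addr_ge0 ?sqr_ge0 // lerDr sqr_ge0.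
Qed.

Lemma complex_cvg_dist (R : realType) (f : nat -> R[i]) (D : R) m0 :
  (forall m n, (m0 <= m)%N -> (m <= n)%N -> `|f n - f m| <= (D / m%:R)%:C) ->
  exists l : R[i], ((f : nat -> R[i]^o) @ \oo --> (l : R[i]^o))%classic.
Proof.
move=> hf.
have [m n lem0m lemn|x fx] := @real_cvg_dist R (fun n => complex.Re (f n)) D m0.
  by have := norm_Re_le (hf _ _ lem0m lemn); case: (f n) => ? ?; case: (f m).
have [m n lem0m lemn|y fy] := @real_cvg_dist R (fun n => complex.Im (f n)) D m0.
  by have := norm_Im_le (hf _ _ lem0m lemn); case: (f n) => ? ?; case: (f m).
by exists (x +i* y); exact: complex_cvg.
Qed.

(** Started at any [p >= m], [ratio_dist_le] gives a Cauchy bound of order [1 / p]. Started at [m],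
    where [2 * C / m <= 1 / 2], it keeps [f n] within [|f m| / 2] of [f m], so the limit cannot be
    0. *)
Lemma ratio_cvg (R : realType) (f : nat -> R[i]) (C : R) m :
  (0 < m)%N -> 0 <= C -> 4 * C <= m%:R ->
  (forall n, (m <= n)%N ->
     `|f n.+1 - f n| <= `|f n| * (C * (n%:R^-1 - n.+1%:R^-1))%:C) ->
  f m != 0 ->
  exists2 l : R[i], l != 0 & ((f : nat -> R[i]^o) @ \oo --> (l : R[i]^o))%classic.
Proof.
move=> m0 C0 Cm hf fm0.
have nC n : (n%:R)%:C = n%:R :> R[i] by rewrite rmorph_nat.
have H p n : (m <= p)%N -> (p <= n)%N ->
    `|f n - f p| <= `|f p| * (2 * C%:C * (p%:R^-1 - n%:R^-1)).
  move=> lemp lepn; apply: ratio_dist_le lepn.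
  - exact: leq_trans lemp.
  - by rewrite lecR.
  - rewrite -[4]nC -[p%:R]nC -rmorphM lecR (le_trans Cm) //.
    by rewrite ler_nat.
  - move=> k lepk; have := hf k (leq_trans lemp lepk).
    by rewrite rmorphM rmorphB /= !fmorphV /= !nC.
have H1 p n : (m <= p)%N -> (p <= n)%N -> `|f n - f p| <= `|f p| * (2 * C / p%:R)%:C.
  move=> lemp lepn; apply: (le_trans (H _ _ lemp lepn)).
  rewrite ler_wpM2l // !rmorphM /= fmorphV /= !nC.
  by rewrite ler_wpM2l ?mulr_ge0 ?lecR // gerBl invr_ge0.
have Hm n : (m <= n)%N -> `|f n - f m| <= `|f m| / 2.
  move=> lemn; apply: (le_trans (H1 _ _ (leqnn m) lemn)); rewrite ler_wpM2l //.
  rewrite -[X in _ <= X](_ : (1 / 2 : R)%:C = _); last first.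
    by rewrite mul1r fmorphV rmorph_nat.
  rewrite lecR ler_pdivrMr ?ltr0n //; lra.
have Hb n : (m <= n)%N -> `|f n| <= `|f m| * 2.
  move=> lemn; rewrite -[f n](subrK (f m)) (le_trans (ler_normD _ _)) //.
  rewrite (_ : `|f m| * 2 = `|f m| + `|f m|); last by ring.
  by rewrite lerD2r (le_trans (Hm _ lemn)) // ler_pdivrMr // ler_peMr // ler1n.
have [l fl] : exists l : R[i], ((f : nat -> R[i]^o) @ \oo --> (l : R[i]^o))%classic.
  apply: (@complex_cvg_dist R f (complex.Re `|f m| * 2 * (2 * C)) m) => p n lemp lepn.
  apply: (le_trans (H1 _ _ lemp lepn)).
  have -> : complex.Re `|f m| * 2 * (2 * C) / p%:R
            = complex.Re `|f m| * 2 * (2 * C / p%:R) by rewrite !mulrA.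
  rewrite [X in _ <= X]rmorphM ler_wpM2r //; first by rewrite lecR !mulr_ge0 ?invr_ge0.
  by rewrite rmorphM /= -normc_real nC Hb.
exists l => //; apply/eqP => l0; move: fl; rewrite l0 => /cvgrPdist_lt.
have f2 : 0 < `|f m| / 2 by rewrite divr_gt0 // normr_gt0.
move=> /(_ _ f2)[N _ /(_ (maxn N m) (leq_maxl _ _))] /=.
rewrite sub0r normrN => fN.
suff fm : `|f m - f (maxn N m)| + `|f (maxn N m)| < `|f m|.
  have := le_lt_trans (ler_normD (f m - f (maxn N m)) (f (maxn N m))) fm.
  by rewrite subrK ltxx.
by rewrite [X in _ < X](splitr `|f m|) distrC ler_ltD // Hm // leq_maxr.
Qed.

Definition gauss_seq (R : realType) (z : R[i]) n : R[i] :=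
  n`!%:R * rcpow n%:R z / pochhammer z n.+1.

Lemma natC (R : realType) n : (n%:R : R)%:C = n%:R :> R[i].
Proof. by rewrite rmorph_nat. Qed.

(** Both bounds are [ln (1 + t) <= t]: at [t = 1 / n], and at [t = - 1 / (n + 1)] because
    [1 + 1 / n] is the inverse of [1 - 1 / (n + 1)]. *)
Lemma ln_succ_bounds (R : realType) n : (0 < n)%N ->
  n.+1%:R^-1 <= ln (n.+1%:R / n%:R : R) <= n%:R^-1.
Proof.
move=> n0; have np : 0 < n%:R :> R by rewrite ltr0n.
have sp : 0 < n.+1%:R :> R by rewrite ltr0n.
have -> : n.+1%:R / n%:R = 1 + n%:R^-1 :> R.
  by rewrite -natr1 mulrDl divff ?gt_eqF // mul1r.
apply/andP; split; last by rewrite le_ln1Dx // (lt_trans (ltrN10 R)) // invr_gt0.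
have -> : 1 + n%:R^-1 = (1 + - n.+1%:R^-1)^-1 :> R.
  by rewrite -natr1; field; rewrite addrK natr1 !gt_eqF.
rewrite lnV ?posrE; last first.
  by rewrite subr_gt0 invf_lt1 // ltr1n.
rewrite lerNr le_ln1Dx // ltrN2 invf_lt1 // ltr1n //.
Qed.

Lemma gauss_seqS (R : realType) (z : R[i]) n : (0 < n)%N -> z + n.+1%:R != 0 ->
  gauss_seq z n.+1
  = gauss_seq z n * (n.+1%:R * cexp z (ln (n.+1%:R / n%:R)) / (z + n.+1%:R)).
Proof.
move=> n0 zn; have np : 0 < n%:R :> R by rewrite ltr0n.
have sp : 0 < n.+1%:R :> R by rewrite ltr0n.
rewrite /gauss_seq factS natrM !rcpowE // pochhammerSr.
have -> : ln (n.+1%:R : R) = ln n%:R + ln (n.+1%:R / n%:R).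
  by rewrite ln_div ?posrE // addrC subrK.
by rewrite cexpD invfM; ring.
Qed.

Lemma gauss_seq_cvg (R : realType) (z : R[i]) : ~ nonposint z ->
  exists2 l : R[i], l != 0
    & ((gauss_seq z : nat -> R[i]^o) @ \oo --> (l : R[i]^o))%classic.
Proof.
move=> hz.
have z0 n : z + n%:R != 0 by exact/nonposint_neq0/nonposintD.
pose s := complex.Re z; pose t := complex.Im z; pose a := complex.Re `|z|.
have a0 : 0 <= a by rewrite -lecR -normc_real rmorph0.
(* The error [5 |z|^2 u^2 + (|s| + |t|) d] of [cexp_approx], with [u^2 <= 2 (1/n - 1/(n+1))] and
   [d = 1/n - 1/(n+1)], doubled because [|z + n + 1| >= (n + 1) / 2]. *)
pose C := 20 * (s ^+ 2 + t ^+ 2) + 2 * (`|s| + `|t|).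
have C0 : 0 <= C by rewrite addr_ge0 // mulr_ge0 // addr_ge0 // sqr_ge0.
(* One threshold for four demands: [4 * C <= m], [|s * u| <= 1 / 2], [|t * u| <= 1], and
   [2 |z| <= n], which bounds the denominator from below. *)
pose m := (Num.truncn (4 * C + 2 * `|s| + `|t| + 2 * a)).+1.
have mlt : 4 * C + 2 * `|s| + `|t| + 2 * a < m%:R by exact: truncnS_gt.
have s0 := normr_ge0 s; have t0 := normr_ge0 t.
have Cm : 4 * C <= m%:R by lra.
have m0 : (0 < m)%N by [].
clearbody m.
apply: (@ratio_cvg _ _ C m) => //.
  move=> n lemn.
  have n0 : (0 < n)%N by exact: leq_trans lemn.
  have np : 0 < n%:R :> R by rewrite ltr0n.
  have sp : 0 < n.+1%:R :> R by rewrite ltr0n.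
  have mn : m%:R <= n%:R :> R by rewrite ler_nat.
  rewrite gauss_seqS // -{2}[gauss_seq z n]mulr1 -mulrBr normrM ler_wpM2l //.
  have /andP[u1 u2] := ln_succ_bounds R n0.
  set u := ln _ in u1 u2 *.
  have u0 : 0 <= u by rewrite (le_trans _ u1) // invr_ge0.
  (* Since [(n + 1) (1 + z / (n + 1)) = z + n + 1], the first-order part of the power cancels
     against the denominator, leaving a ratio of [1 + O(1/n^2)]. *)
  have -> : n.+1%:R * cexp z u / (z + n.+1%:R) - 1
     = n.+1%:R * (cexp z u - 1 - z * (n.+1%:R^-1)%:C) / (z + n.+1%:R).
    rewrite fmorphV /= natC; have : n.+1%:R != 0 :> R[i] by rewrite pnatr_eq0.
    by move: (z0 n.+1); move: (n.+1%:R : R[i]) => N zN N0; field; rewrite zN N0.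
  have su : `|s * u| <= 1 / 2.
    rewrite normrM (ger0_norm u0) (le_trans (ler_wpM2l s0 u2)) //.
    by rewrite ler_pdivrMr //; lra.
  have tu : `|t * u| <= 1.
    rewrite normrM (ger0_norm u0) (le_trans (ler_wpM2l t0 u2)) //.
    by rewrite ler_pdivrMr //; lra.
  have uv : `|u - n.+1%:R^-1| <= n%:R^-1 - n.+1%:R^-1.
    by rewrite ger0_norm ?subr_ge0 // lerD2r.
  have := cexp_approx su tu uv.
  set w := cexp z u - 1 - _ => hw.
  have zn : (n.+1%:R / 2)%:C <= `|z + n.+1%:R|.
    have := ler_normB (z + n.+1%:R) z; rewrite addrC addKr normr_nat.
    rewrite -lerBlDr; apply: le_trans.
    rewrite normc_real -natC -rmorphB lecR -/a -natr1; lra.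
  have zn0 : 0 < `|z + n.+1%:R| by rewrite normr_gt0.
  rewrite !normrM normfV normr_nat ler_pdivrMr //.
  apply: (@le_trans _ _ ((C * (n%:R^-1 - n.+1%:R^-1))%:C * (n.+1%:R / 2)%:C)); last first.
    rewrite ler_wpM2l // lecR mulr_ge0 // subr_ge0 (le_trans u1) //.
  rewrite -natC.
  apply: (le_trans (ler_wpM2l _ hw)); first by rewrite lecR.
  rewrite -!rmorphM lecR -/s -/t; set v := n%:R^-1 - _.
  have uv2 : u ^+ 2 <= 2 * v.
    have -> : v = n%:R^-1 * n.+1%:R^-1.
      by rewrite /v -natr1; field; rewrite natr1 !gt_eqF.
    rewrite (@le_trans _ _ (n%:R^-1 ^+ 2)) ?lerXn2r ?nnegrE ?invr_ge0 //.
    rewrite expr2 mulrCA ler_wpM2l ?invr_ge0 // -[leLHS]mul1r ler_pdivlMr //.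
    by rewrite mulrAC ler_pdivrMr // -natr1; have : 1 <= n%:R :> R; [rewrite ler1n|lra].
  have -> : C * v * (n.+1%:R / 2) = n.+1%:R * (C * v / 2) by ring.
  rewrite ler_wpM2l ?(ltW sp) //.
  have -> : C * v / 2 = 5 * (s ^+ 2 + t ^+ 2) * (2 * v) + (`|s| + `|t|) * v.
    by rewrite /C; field.
  by rewrite lerD2r ler_wpM2l // mulr_ge0 // addr_ge0 // sqr_ge0.
rewrite /gauss_seq !mulf_neq0 ?invr_eq0 ?pnatr_eq0 -?lt0n ?fact_gt0 //.
  by rewrite rcpowE ?ltr0n // cexp_neq0.
exact: pochhammer_neq0.
Qed.

(** * Values and functional equation of Gamma *)

Lemma Gamma_neq0_cvg (R : realType) (z : R[i]) : ~ nonposint z ->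
  Gamma z != 0
  /\ ((gauss_seq z : nat -> R[i]^o) @ \oo --> (Gamma z : R[i]^o))%classic.
Proof.
move=> /gauss_seq_cvg[l l0 zl].
by have -> : Gamma z = l by exact: (cvg_lim (@norm_hausdorff _ (R[i]^o))).
Qed.

Lemma Gamma_nonposint (R : realType) (z : R[i]) : nonposint z -> Gamma z = 0.
Proof.
move=> [m ->]; apply: (lim_near_cst (@norm_hausdorff _ (R[i]^o))).
by exists m => // n /= lemn; rewrite pochhammer_eq0 // invr0 mulr0.
Qed.

Lemma cvg_lim_ratio (K : numFieldType) (f g : nat -> K^o) (x y w c : K) :
  (f @ \oo --> (x : K^o))%classic -> (g @ \oo --> (y : K^o))%classic ->
  ((fun n => n%:R^-1 : K^o) @ \oo --> (0 : K^o))%classic ->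
  (forall n, (0 < n)%N -> f n * (1 + w * n%:R^-1) = c * g n) ->
  x = c * y.
Proof.
move=> fx gy n0 fg.
have L1 : ((fun n => f n * (1 + w * n%:R^-1) : K^o) @ \oo
    --> (x * (1 + w * 0) : K^o))%classic.
  apply: cvgM => //; apply: cvgD; first exact: cvg_cst.
  by apply: cvgM => //; exact: cvg_cst.
have L2 : ((fun n => c * g n : K^o) @ \oo --> (c * y : K^o))%classic.
  by apply: cvgM => //; exact: cvg_cst.
rewrite -[LHS]mulr1 -[X in _ * X]addr0 -[X in _ * (_ + X)](mulr0 w).
apply: (cvg_unique (@norm_hausdorff _ K^o) L1).
by apply: cvg_trans L2; apply: near_eq_cvg; exists 1%N => // n /= n1; rewrite fg.
Qed.

Lemma cvg_complex_inv_nat (R : realType) :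
  ((fun n => n%:R^-1 : R[i]^o) @ \oo --> (0 : R[i]^o))%classic.
Proof.
apply/cvgrPdist_lt => -[e e']; rewrite ltcE /= => /andP[/eqP -> e0].
exists (Num.truncn e^-1).+1 => // n /= ltn.
have en : e^-1 < n%:R by rewrite (lt_le_trans (truncnS_gt _)) // ler_nat.
have np : 0 < n%:R :> R by rewrite (lt_trans _ en) // invr_gt0.
rewrite sub0r normrN normfV normr_nat -natC -fmorphV -[X in _ < X]/(e%:C) ltcR.
by rewrite -[ltRHS]invrK ltf_pV2 ?posrE ?invr_gt0.
Qed.

(** At finite [n] the functional equation holds up to the factor [1 + (z + 1) / n], which tends to
    1. *)
Lemma GammaS (R : realType) (z : R[i]) : ~ nonposint z ->
  Gamma (z + 1) = z * Gamma z.
Proof.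
move=> hz.
have hz1 : ~ nonposint (z + 1) by exact: (@nonposintD _ _ 1).
have [_ gz] := Gamma_neq0_cvg hz; have [_ gz1] := Gamma_neq0_cvg hz1.
have z0 := nonposint_neq0 hz.
apply: (@cvg_lim_ratio R[i] _ _ _ _ (z + 1) z gz1 gz (@cvg_complex_inv_nat R)).
move=> n n0.
have np : 0 < n%:R :> R by rewrite ltr0n.
have nn0 : n%:R != 0 :> R[i] by rewrite pnatr_eq0 -lt0n.
have := pochhammer_neq0 n.+2 hz; have e := pochhammerSl z n.+1.
rewrite e mulf_eq0 negb_or => /andP[_ p0].
have zn0 : z + n.+1%:R != 0 by exact/nonposint_neq0/nonposintD.
have e' : pochhammer z n.+1 = z * pochhammer (z + 1) n.+1 / (z + n.+1%:R).
  by rewrite -e [in RHS]pochhammerSr mulfK.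
rewrite /gauss_seq !rcpowE // cexp_add1 // natC e'.
move: p0 zn0; rewrite -natr1; set p := pochhammer _ _ => p0 zn0.
by field; rewrite p0 zn0 z0 nn0.
Qed.

Lemma GammaD_nat (R : realType) (z : R[i]) n : ~ nonposint z ->
  Gamma (z + n%:R) = pochhammer z n * Gamma z.
Proof.
move=> hz; elim: n => [|n IHn]; first by rewrite addr0 pochhammer0 mul1r.
rewrite -natr1 addrA GammaS ?IHn; last exact: nonposintD.
by rewrite pochhammerSr mulrCA mulrA.
Qed.

(* Also at the poles of Gamma, where both sides are 0. *)
Lemma GammaV_pochhammer (R : realType) (z : R[i]) n : ~ nonposint (z + n%:R) ->
  (Gamma z)^-1 = pochhammer z n / Gamma (z + n%:R).
Proof.
move=> hzn; have [[m zm] | hz] := pselect (nonposint z).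
  rewrite Gamma_nonposint ?invr0; last by exists m.
  have [ltmn | lenm] := ltnP m n.
    by rewrite zm pochhammer_eq0 // mul0r.
  by case: hzn; exists (m - n)%N; rewrite zm natrB // opprB addrC.
have [G0 _] := Gamma_neq0_cvg hz.
by rewrite GammaD_nat // invfM mulVKf //; apply: pochhammer_neq0.
Qed.

(** * Closed forms for the Gauss series *)

Lemma floor_halfE (j i : int) : i * 2 <= j < i * 2 + 2 -> floor_half j = i.
Proof.
move=> /andP[ij ji]; apply: floor_def.
rewrite ler_pdivlMr // ltr_pdivrMr //.
rewrite (_ : 2 = 2%:~R :> rat) // -!intrM ler_int ltr_int ij mulrDl mul1r //.
Qed.

(** [KA] and [KB] stand for the two Gamma quotients, kept abstract so that they can be replaced by
    rational functions of [b]. The symbols of [1 / 2] and [1 / 2 + 1] are there to cancel those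
    produced by [(2m)!] and [(2m + 1)!]. *)
Definition gauss2_closed (R : realType) (j : int) (b KA KB : R[i]) := forall m,
  gauss2 b (2 * b + j%:~R) m.*2
    = KA * Acoef j b m
      * (pochhammer (1 / 2) m * pochhammer (b + (floor_half (j + 1))%:~R) m
      / (pochhammer (b + j%:~R / 2) m * pochhammer (b + j%:~R / 2 + 1 / 2) m))
  /\ gauss2 b (2 * b + j%:~R) m.*2.+1
    = KB / (2 * b + j%:~R) * Bcoef j b m
      * (pochhammer (1 / 2 + 1) m * pochhammer (b + 1 + (floor_half j)%:~R) m
      / (pochhammer (b + j%:~R / 2 + 1 / 2) m * pochhammer (b + j%:~R / 2 + 1) m)).

(** With [h = b + j / 2], both floors equal [j / 2], so the floor-shifted parameters are [h] and
    [h + 1] and cancel against a lower symbol. *)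
Lemma gauss2_closed_even (R : realType) (j i : int) (b KA KB : R[i]) :
  j = i * 2 -> ~ nonposint (2 * b + j%:~R) ->
  ~ nonposint (b + j%:~R / 2) -> ~ nonposint (b + j%:~R / 2 + 1 / 2) ->
  KA * Acoef j b 0 = 1 -> KB * Bcoef j b 0 = j%:~R ->
  (forall m, (2 * b + j%:~R) * (KA * Acoef j b m.+1)
     = j%:~R * (KB * Bcoef j b m) + (2 * b + j%:~R) * (KA * Acoef j b m)) ->
  (forall m, (2 * b + j%:~R + m.*2.+2%:R) * m.*2.+3%:R * (KB * Bcoef j b m.+1)
     = j%:~R * (2 * b + j%:~R) * (KA * Acoef j b m.+1)
       + m.*2.+2%:R * (2 * b + j%:~R + m.*2.+1%:R) * (KB * Bcoef j b m)) ->
  gauss2_closed j b KA KB.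
Proof.
move=> ji hc hh hh2 A0 B0 hA hB m.
have -> : floor_half (j + 1) = i by apply: floor_halfE; lia.
have -> : floor_half j = i by apply: floor_halfE; lia.
have i2 : i%:~R = j%:~R / 2 :> R[i] by rewrite ji rmorphM /= mulfK ?pnatr_eq0.
have ch : 2 * b + j%:~R = 2 * (b + j%:~R / 2) by field.
have cb : j%:~R = 2 * (b + j%:~R / 2) - 2 * b by field.
have b1 : b + 1 + i%:~R = b + j%:~R / 2 + 1 by rewrite i2; ring.
have p0 := pochhammer_neq0 m hh; have p1 := pochhammer_neq0 m hh2.
have hh1 : ~ nonposint (b + j%:~R / 2 + 1) by exact: (@nonposintD _ _ 1).
have p2 := pochhammer_neq0 m hh1.
rewrite b1 i2; rewrite ch in hc hA hB *.
have [||||n|n|-> ->] := @gauss2_even_shift R b (b + j%:~R / 2)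
   (fun m => KA * Acoef j b m) (fun m => KB * Bcoef j b m) _ _ _ _ _ _ m => //.
- by rewrite -cb.
- by rewrite -cb hA.
- by rewrite -cb hB.
have c0 := nonposint_neq0 hc.
move: p0 p1 p2 c0; set h := b + _ => p0 p1 p2 c0; split.
  by field; rewrite p0 p1.
by have h0 := nonposint_neq0 hh; field; rewrite p2 p1 h0.
Qed.

(** The floors are [i] and [i - 1], so both floor-shifted parameters [b + i] and [b + 1 + (i - 1)]
    equal [b + j / 2 + 1 / 2] and cancel against a lower symbol. *)
Lemma gauss2_closed_odd (R : realType) (j i : int) (b KA KB : R[i]) :
  j = i * 2 - 1 -> ~ nonposint (2 * b + j%:~R) ->
  ~ nonposint (b + j%:~R / 2) -> ~ nonposint (b + j%:~R / 2 + 1 / 2) ->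
  KA * Acoef j b 0 = 1 -> KB * Bcoef j b 0 = j%:~R ->
  (forall m, (2 * b + j%:~R + m.*2.+1%:R) * (KA * Acoef j b m.+1)
     = j%:~R * (KB * Bcoef j b m) + (2 * b + j%:~R + m.*2%:R) * (KA * Acoef j b m)) ->
  (forall m, m.*2.+3%:R * (KB * Bcoef j b m.+1)
     = j%:~R * (KA * Acoef j b m.+1) + m.*2.+2%:R * (KB * Bcoef j b m)) ->
  gauss2_closed j b KA KB.
Proof.
move=> ji hc hh hh2 A0 B0 hA hB m.
have -> : floor_half (j + 1) = i by apply: floor_halfE; lia.
have -> : floor_half j = i - 1 by apply: floor_halfE; lia.
have i2 : i%:~R = j%:~R / 2 + 1 / 2 :> R[i].
  by rewrite ji rmorphB rmorphM /=; field.
have ch : 2 * b + j%:~R = 2 * (b + j%:~R / 2) by field.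
have cb : j%:~R = 2 * (b + j%:~R / 2) - 2 * b by field.
have b1 : b + 1 + (i - 1)%:~R = b + j%:~R / 2 + 1 / 2.
  by rewrite rmorphB /= i2; ring.
have p0 := pochhammer_neq0 m hh; have p1 := pochhammer_neq0 m hh2.
have hh1 : ~ nonposint (b + j%:~R / 2 + 1) by exact: (@nonposintD _ _ 1).
have p2 := pochhammer_neq0 m hh1.
rewrite b1 i2 addrA; rewrite ch in hc hA hB *.
have [||||n|n|-> ->] := @gauss2_odd_shift R b (b + j%:~R / 2)
   (fun m => KA * Acoef j b m) (fun m => KB * Bcoef j b m) _ _ _ _ _ _ m => //.
- by rewrite -cb.
- by rewrite -cb hA.
- by rewrite -cb hB.
have c0 := nonposint_neq0 hc.
move: p0 p1 p2 c0; set h := b + _ => p0 p1 p2 c0; split.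
  by field; rewrite p0 p1.
by have h0 := nonposint_neq0 hh; field; rewrite p2 p1 h0.
Qed.

(** Finiteness of [Gamma b] and [Gamma (1 - b)] together says that [b] is not an integer; in this
    form it yields directly that each linear factor in the quotients is nonzero. *)
Definition nonint (R : realType) (b : R[i]) := forall n : int, b + n%:~R != 0.

Lemma nonint_nonposint (R : realType) (b : R[i]) : nonint b ->
  ~ nonposint b /\ ~ nonposint (1 - b).
Proof.
move=> hb; split.
  by case=> m bm; have := hb m; rewrite bm addNr eqxx.
case=> m bm; have := hb (- 1 - m%:Z); apply/negP; rewrite negbK.
by rewrite rmorphB /= -[m%:~R]opprK -bm; apply/eqP; ring.
Qed.

Lemma Gamma_ratio_pos (R : realType) (b : R[i]) (n k : nat) :
  nonint b -> Gamma b * Gamma (1 - b) / (Gamma (b + n%:R) * Gamma (1 - b - k%:R))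
  = pochhammer (1 - b - k%:R) k / pochhammer b n.
Proof.
move=> /nonint_nonposint[hb0 hb1].
have [G0 _] := Gamma_neq0_cvg hb0; have [G1 _] := Gamma_neq0_cvg hb1.
have e : 1 - b - k%:R + k%:R = 1 - b by ring.
rewrite invfM (@GammaV_pochhammer _ (1 - b - k%:R) k) e // GammaD_nat //.
have p0 := pochhammer_neq0 n hb0.
by field; rewrite G0 G1 p0.
Qed.

Lemma Gamma_ratio_neg (R : realType) (b : R[i]) (n k : nat) :
  nonint b -> Gamma b * Gamma (1 - b) / (Gamma (b + n%:R) * Gamma (1 - b + k%:R))
  = (pochhammer (1 - b) k * pochhammer b n)^-1.
Proof.
move=> /nonint_nonposint[hb0 hb1].
have [G0 _] := Gamma_neq0_cvg hb0; have [G1 _] := Gamma_neq0_cvg hb1.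
rewrite !GammaD_nat //.
have p0 := pochhammer_neq0 n hb0; have p1 := pochhammer_neq0 k hb1.
by field; rewrite G0 G1 p0 p1.
Qed.

(** Reduces the numerator in front of the [B] series to that in front of the [A] series. *)
Lemma Gamma_reflect (R : realType) (b : R[i]) : nonint b ->
  Gamma (- b) * Gamma (1 + b) = - (Gamma b * Gamma (1 - b)).
Proof.
move=> hb; have [hb0 hb1] := nonint_nonposint hb.
have hbN : ~ nonposint (- b).
  by case=> m bm; have := hb (- m%:Z); rewrite rmorphN /= -bm subrr eqxx.
by rewrite (addrC 1 b) (addrC 1 (- b)) !GammaS //; ring.
Qed.

Definition GammaA (R : realType) (j : int) (b : R[i]) :=
  Gamma b * Gamma (1 - b)
      / (Gamma (b + j%:~R / 2 + `|j|%:~R / 2)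
         * Gamma (1 - b - (floor_half (j + 1))%:~R)).

Definition GammaB (R : realType) (j : int) (b : R[i]) :=
  Gamma (- b) * Gamma (1 + b)
      / (Gamma (b + j%:~R / 2 + `|j|%:~R / 2)
         * Gamma (- b - (floor_half j)%:~R)).

(** The shift [j / 2 + |j| / 2] is [j] for [j >= 0] and 0 for [j < 0], hence always a natural
    number, and the quotient is rational in [b]. For negative [j] the factor [Gamma b] cancels
    altogether. *)
Lemma GammaA_pos (R : realType) (n k : nat) (b : R[i]) : nonint b ->
  floor_half (n%:Z + 1) = k ->
  GammaA n b = pochhammer (1 - b - k%:R) k / pochhammer b n.
Proof.
move=> hb nk; rewrite -Gamma_ratio_pos // /GammaA nk (@ger0_norm _ n%:Z) //.
by rewrite -addrA -splitr.
Qed.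

Lemma GammaB_pos (R : realType) (n k : nat) (b : R[i]) : nonint b ->
  floor_half n%:Z = k%:Z - 1 ->
  GammaB n b = - (pochhammer (1 - b - k%:R) k / pochhammer b n).
Proof.
move=> hb nk; rewrite -Gamma_ratio_pos // /GammaB nk.
rewrite (@ger0_norm _ n%:Z) // Gamma_reflect //.
rewrite -addrA -splitr mulNr; congr (- (_ / (_ * Gamma _))).
by rewrite rmorphB /=; ring.
Qed.

Lemma GammaA_neg (R : realType) (n k : nat) (b : R[i]) : nonint b ->
  floor_half (Negz n + 1) = - k%:Z ->
  GammaA (Negz n) b = (pochhammer (1 - b) k)^-1.
Proof.
move=> hb nk; rewrite -[RHS](_ : (pochhammer (1 - b) k * pochhammer b 0)^-1 = _).
  rewrite -Gamma_ratio_neg // /GammaA nk; congr (_ / (Gamma _ * Gamma _)).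
    by rewrite NegzE normrN (@ger0_norm _ n.+1%:Z) // rmorphN /=; ring.
  by rewrite rmorphN /= opprK.
by rewrite pochhammer0 mulr1.
Qed.

Lemma GammaB_neg (R : realType) (n k : nat) (b : R[i]) : nonint b ->
  floor_half (Negz n) = - k%:Z - 1 ->
  GammaB (Negz n) b = - (pochhammer (1 - b) k)^-1.
Proof.
move=> hb nk.
rewrite -[in RHS](_ : (pochhammer (1 - b) k * pochhammer b 0)^-1
                      = (pochhammer (1 - b) k)^-1).
  rewrite -Gamma_ratio_neg // /GammaB nk Gamma_reflect // mulNr.
  congr (- (_ / (Gamma _ * Gamma _))).
    by rewrite NegzE normrN (@ger0_norm _ n.+1%:Z) // rmorphN /=; ring.
  by rewrite rmorphB rmorphN /=; ring.
by rewrite pochhammer0 mulr1.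
Qed.

Lemma doubleR (F : pzSemiRingType) m :
  (m.*2%:R = 2 * m%:R :> F) * (m.*2.+2%:R = 2 * m%:R + 2 :> F)
  * (m.*2.+3%:R = 2 * m%:R + 3 :> F).
Proof.
by rewrite -[m.*2.+3]addn3 -[m.*2.+2]addn2 !natrD -mul2n natrM.
Qed.

Ltac simp_coef :=
  first [ let m := fresh "m" in
          move=> m; rewrite /= ?doubleR ?double1R -?[m.+1%:R]natr1
        | rewrite /= ].

Ltac simp_poch nz :=
  rewrite ?pochhammerSr ?pochhammer0; field; rewrite ?nz.

(** For a fixed [j] the two quotients become explicit rational functions of [b], with denominators
    among the linear factors collected in [nz]; the initial values and the recurrences are then
    identities for [field]. *)
Lemma gauss2_closed_Gamma (R : realType) (j : int) (b : R[i]) :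
  -5 <= j <= 5 -> nonint b -> ~ nonposint (2 * b + j%:~R) ->
  ~ nonposint (b + j%:~R / 2) -> ~ nonposint (b + j%:~R / 2 + 1 / 2) ->
  gauss2_closed j b (GammaA j b) (GammaB j b).
Proof.
move=> hj hb.
have b0 : b != 0 by rewrite -[b]addr0 (hb 0).
have b1 : b + 1 != 0 by exact: (hb 1).
have b2 : b + 2 != 0 by exact: (hb 2).
have b3 : b + 3 != 0 by exact: (hb 3).
have b4 : b + 4 != 0 by exact: (hb 4).
have c1 : 1 - b != 0 by rewrite -opprB oppr_eq0; exact: (hb (- 1)).
have c2 : 2 - b != 0 by rewrite -opprB oppr_eq0; exact: (hb (- 2)).
have nz := (b0, b1, b2, b3, b4, c1, c2).
case: j hj => [[|[|[|[|[|[|n]]]]]]|[|[|[|[|[|n]]]]]] hj hc hh hh2; try lia.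
- have fA : floor_half ((Posz 0) + 1) = (Posz 0) by exact: floor_halfE.
  have fB : floor_half (Posz 0) = (Posz 1 - 1) by exact: floor_halfE.
  have -> : GammaA (Posz 0) b = 1.
    by rewrite (GammaA_pos hb fA); simp_poch nz.
  have -> : GammaB (Posz 0) b = b.
    by rewrite (GammaB_pos hb fB); simp_poch nz.
  apply: (@gauss2_closed_even _ _ (0) _ _ _ erefl hc hh hh2);
    by simp_coef; field; rewrite ?nz.
- have fA : floor_half ((Posz 1) + 1) = (Posz 1) by exact: floor_halfE.
  have fB : floor_half (Posz 1) = (Posz 1 - 1) by exact: floor_halfE.
  have -> : GammaA (Posz 1) b = -1.
    by rewrite (GammaA_pos hb fA); simp_poch nz.
  have -> : GammaB (Posz 1) b = 1.
    by rewrite (GammaB_pos hb fB); simp_poch nz.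
  apply: (@gauss2_closed_odd _ _ (1) _ _ _ erefl hc hh hh2);
    by simp_coef; field; rewrite ?nz.
- have fA : floor_half ((Posz 2) + 1) = (Posz 1) by exact: floor_halfE.
  have fB : floor_half (Posz 2) = (Posz 2 - 1) by exact: floor_halfE.
  have -> : GammaA (Posz 2) b = (- (b + 1)^-1).
    by rewrite (GammaA_pos hb fA); simp_poch nz.
  have -> : GammaB (Posz 2) b = -1.
    by rewrite (GammaB_pos hb fB); simp_poch nz.
  apply: (@gauss2_closed_even _ _ (1) _ _ _ erefl hc hh hh2);
    by simp_coef; field; rewrite ?nz.
- have fA : floor_half ((Posz 3) + 1) = (Posz 2) by exact: floor_halfE.
  have fB : floor_half (Posz 3) = (Posz 2 - 1) by exact: floor_halfE.
  have -> : GammaA (Posz 3) b = (b + 2)^-1.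
    by rewrite (GammaA_pos hb fA); simp_poch nz.
  have -> : GammaB (Posz 3) b = (- (b + 2)^-1).
    by rewrite (GammaB_pos hb fB); simp_poch nz.
  apply: (@gauss2_closed_odd _ _ (2) _ _ _ erefl hc hh hh2);
    by simp_coef; field; rewrite ?nz.
- have fA : floor_half ((Posz 4) + 1) = (Posz 2) by exact: floor_halfE.
  have fB : floor_half (Posz 4) = (Posz 3 - 1) by exact: floor_halfE.
  have -> : GammaA (Posz 4) b = ((b + 2) * (b + 3))^-1.
    by rewrite (GammaA_pos hb fA); simp_poch nz.
  have -> : GammaB (Posz 4) b = (b + 3)^-1.
    by rewrite (GammaB_pos hb fB); simp_poch nz.
  apply: (@gauss2_closed_even _ _ (2) _ _ _ erefl hc hh hh2);
    by simp_coef; field; rewrite ?nz.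
- have fA : floor_half ((Posz 5) + 1) = (Posz 3) by exact: floor_halfE.
  have fB : floor_half (Posz 5) = (Posz 3 - 1) by exact: floor_halfE.
  have -> : GammaA (Posz 5) b = (- ((b + 3) * (b + 4))^-1).
    by rewrite (GammaA_pos hb fA); simp_poch nz.
  have -> : GammaB (Posz 5) b = ((b + 3) * (b + 4))^-1.
    by rewrite (GammaB_pos hb fB); simp_poch nz.
  apply: (@gauss2_closed_odd _ _ (3) _ _ _ erefl hc hh hh2);
    by simp_coef; field; rewrite ?nz.
- have fA : floor_half ((Negz 0) + 1) = (- (Posz 0)) by exact: floor_halfE.
  have fB : floor_half (Negz 0) = (- (Posz 0) - 1) by exact: floor_halfE.
  have -> : GammaA (Negz 0) b = 1.
    by rewrite (GammaA_neg hb fA); simp_poch nz.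
  have -> : GammaB (Negz 0) b = -1.
    by rewrite (GammaB_neg hb fB); simp_poch nz.
  apply: (@gauss2_closed_odd _ _ (0) _ _ _ erefl hc hh hh2);
    by simp_coef; field; rewrite ?nz.
- have fA : floor_half ((Negz 1) + 1) = (- (Posz 1)) by exact: floor_halfE.
  have fB : floor_half (Negz 1) = (- (Posz 0) - 1) by exact: floor_halfE.
  have -> : GammaA (Negz 1) b = (1 - b)^-1.
    by rewrite (GammaA_neg hb fA); simp_poch nz.
  have -> : GammaB (Negz 1) b = -1.
    by rewrite (GammaB_neg hb fB); simp_poch nz.
  apply: (@gauss2_closed_even _ _ (-1) _ _ _ erefl hc hh hh2);
    by simp_coef; field; rewrite ?nz.
- have fA : floor_half ((Negz 2) + 1) = (- (Posz 1)) by exact: floor_halfE.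
  have fB : floor_half (Negz 2) = (- (Posz 1) - 1) by exact: floor_halfE.
  have -> : GammaA (Negz 2) b = (1 - b)^-1.
    by rewrite (GammaA_neg hb fA); simp_poch nz.
  have -> : GammaB (Negz 2) b = (- (1 - b)^-1).
    by rewrite (GammaB_neg hb fB); simp_poch nz.
  apply: (@gauss2_closed_odd _ _ (-1) _ _ _ erefl hc hh hh2);
    by simp_coef; field; rewrite ?nz.
- have fA : floor_half ((Negz 3) + 1) = (- (Posz 2)) by exact: floor_halfE.
  have fB : floor_half (Negz 3) = (- (Posz 1) - 1) by exact: floor_halfE.
  have -> : GammaA (Negz 3) b = ((1 - b) * (2 - b))^-1.
    by rewrite (GammaA_neg hb fA); simp_poch nz.
  have -> : GammaB (Negz 3) b = (- (1 - b)^-1).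
    by rewrite (GammaB_neg hb fB); simp_poch nz.
  apply: (@gauss2_closed_even _ _ (-2) _ _ _ erefl hc hh hh2);
    by simp_coef; field; rewrite ?nz.
- have fA : floor_half ((Negz 4) + 1) = (- (Posz 2)) by exact: floor_halfE.
  have fB : floor_half (Negz 4) = (- (Posz 2) - 1) by exact: floor_halfE.
  have -> : GammaA (Negz 4) b = ((1 - b) * (2 - b))^-1.
    by rewrite (GammaA_neg hb fA); simp_poch nz.
  have -> : GammaB (Negz 4) b = (- ((1 - b) * (2 - b))^-1).
    by rewrite (GammaB_neg hb fB); simp_poch nz.
  (* At [m = 0] the coefficient [B_{-5}] equals [5 (1 - b) (2 - b)], which the Gamma quotient turns
     into the required [-5]; this fixes its ending [b + 11]. *)
  apply: (@gauss2_closed_odd _ _ (-2) _ _ _ erefl hc hh hh2);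
    by simp_coef; field; rewrite ?nz.
Qed.

(** * Summation of the left-hand side *)

Lemma pochhammer_doubleS (R : realType) (z : R[i]) n :
  pochhammer (2 * z) n.*2.+1
  = 2 * z * 4 ^+ n * (pochhammer (z + 1 / 2) n * pochhammer (z + 1) n).
Proof.
rewrite pochhammerSl (_ : 2 * z + 1 = 2 * (z + 1 / 2)); last by field.
by rewrite pochhammer_double -addrA -splitr !mulrA.
Qed.

Lemma fact_doubleS (R : realType) n :
  n.*2.+1`!%:R = 4 ^+ n * (n`!%:R * pochhammer (1 / 2 + 1 : R[i]) n).
Proof.
have half0 : (1 / 2 : R[i]) != 0 by rewrite mul1r invr_eq0 pnatr_eq0.
rewrite factS natrM fact_double double1R pochhammer_shift //.
by field.
Qed.

(** [Gamma (e - y)] may be at a pole; then [(e - y)_M] vanishes, and [GammaV_pochhammer] covers this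
    case as well. *)
Lemma Gamma_prefactor (R : realType) M (y e : R[i]) :
  ~ nonposint e -> ~ nonposint (e - - M%:R - y) ->
  Gamma e * Gamma (e - - M%:R - y) / (Gamma (e - - M%:R) * Gamma (e - y))
  = pochhammer (e - y) M / pochhammer e M.
Proof.
rewrite opprK => he hey.
have ey : e + M%:R - y = e - y + M%:R by ring.
rewrite ey in hey *.
have [G0 _] := Gamma_neq0_cvg he; have [G1 _] := Gamma_neq0_cvg hey.
rewrite invfM (GammaV_pochhammer hey) (GammaD_nat M he).
have p0 := pochhammer_neq0 M he.
by field; rewrite G0 G1 p0.
Qed.

Definition weight (R : realType) (x y e : R[i]) n : R[i] :=
  pochhammer x n * pochhammer y n / (pochhammer e n * n`!%:R).

Lemma weight_eq0 (R : realType) M (y e : R[i]) n : (M < n)%N ->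
  weight (- M%:R) y e n = 0.
Proof. by move=> ltMn; rewrite /weight pochhammer_eq0 // !mul0r. Qed.

Lemma pFq_prefactor (R : realType) M (b c y e : R[i]) :
  ~ nonposint c -> ~ nonposint e -> ~ nonposint (1 + - M%:R + y - e) ->
  ~ nonposint (e - - M%:R - y) ->
  Gamma e * Gamma (e - - M%:R - y) / (Gamma (e - - M%:R) * Gamma (e - y))
    * pFq [:: - M%:R; b; y] [:: c; 1 + - M%:R + y - e] 2
  = \sum_(n < M.+1) weight (- M%:R) y e n * gauss2 b c n.
Proof.
move=> hc he hf hey; rewrite Gamma_prefactor // -terminating_3F2 //.
congr (_ * _); rewrite /pFq (@csum_finite _ _ M.+1); last first.
  by move=> k ltMk; rewrite !big_cons pochhammer_eq0 // !mul0r.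
by apply: eq_bigr => k _; rewrite !big_cons !big_nil !mulr1 !mulrA.
Qed.

(** The left-hand side is symmetric in [2a] and [d], so whichever of them terminates takes the role
    of [- M]: [M = 2N] for [a = - N], and [M = N], of either parity, for [d = - N]. *)
Lemma prefactor_sum (R : realType) (a b c d e : R[i]) :
  nonposint a \/ nonposint d ->
  ~ nonposint c -> ~ nonposint e -> ~ nonposint (1 + 2 * a + d - e) ->
  ~ nonposint (e - 2 * a - d) ->
  exists2 N, (forall n, (N <= n)%N -> weight (2 * a) d e n = 0) &
  Gamma e * Gamma (e - 2 * a - d) / (Gamma (e - 2 * a) * Gamma (e - d))
    * pFq [:: 2 * a; b; d] [:: c; 1 + 2 * a + d - e] 2
  = \sum_(n < N.*2) weight (2 * a) d e n * gauss2 b c n.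
Proof.
move=> had hc he hf hey.
suff [N w0 ->] : exists2 N, (forall n, (N <= n)%N -> weight (2 * a) d e n = 0) &
  Gamma e * Gamma (e - 2 * a - d) / (Gamma (e - 2 * a) * Gamma (e - d))
    * pFq [:: 2 * a; b; d] [:: c; 1 + 2 * a + d - e] 2
  = \sum_(n < N) weight (2 * a) d e n * gauss2 b c n.
  (* Doubling the range makes it split into [N] even and [N] odd indices; the added terms have
     weight 0. *)
  exists N => //.
  rewrite -!(big_mkord xpredT (fun n => weight (2 * a) d e n * gauss2 b c n)).
  have leN : (N <= N.*2)%N by rewrite -addnn leq_addr.
  rewrite [RHS](big_cat_nat (leq0n N) leN) /=.
  rewrite [X in _ + X]big_nat [X in _ + X]big1 ?addr0 //.
  by move=> n /andP[/w0 -> _]; rewrite mul0r.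
case: had => [[N aN] | [N dN]].
  have e2a : 2 * a = - N.*2%:R by rewrite aN mulrN -mul2n natrM.
  exists N.*2.+1; rewrite e2a in hf hey *; first exact: weight_eq0.
  exact: pFq_prefactor.
have wC n : weight (2 * a) d e n = weight d (2 * a) e n.
  by rewrite /weight (mulrC (pochhammer _ _)).
exists N.+1; first by move=> n; rewrite wC dN; exact: weight_eq0.
under eq_bigr do rewrite wC.
have e1 : 1 + 2 * a + d - e = 1 + d + 2 * a - e by ring.
have e2 : e - 2 * a - d = e - d - 2 * a by ring.
rewrite e1 e2 in hf hey *; rewrite [Gamma (e - 2 * a) * _]mulrC.
have -> : pFq [:: 2 * a; b; d] [:: c; 1 + d + 2 * a - e] 2
        = pFq [:: d; b; 2 * a] [:: c; 1 + d + 2 * a - e] 2.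
  congr csum; apply/funext => n; congr (_ / _ * _).
  by rewrite !big_cons !big_nil; ring.
rewrite dN in hf hey *; exact: pFq_prefactor.
Qed.

Theorem theorem2p1 (R : realType) (j : int) (a b d e : R[i])
  (hj : -5 <= j <= 5)
  (had : nonposint a \/ nonposint d)
  (* no lower parameter is a nonpositive integer *)
  (hlow : forall x : R[i],
     x \in [:: 2 * b + j%:~R; 1 + 2 * a + d - e;
               b + j%:~R / 2; b + j%:~R / 2 + 1 / 2; b + j%:~R / 2 + 1;
               e / 2; e / 2 + 1 / 2; e / 2 + 1] ->
     ~ nonposint x)
  (* the Gamma factors in the numerators are finite *)
  (hGamma : forall x : R[i],
     x \in [:: e; e - 2 * a - d; b; 1 - b; - b; 1 + b] ->
     ~ nonposint x) :
  Gamma e * Gamma (e - 2 * a - d) / (Gamma (e - 2 * a) * Gamma (e - d))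
    * pFq [:: 2 * a; b; d] [:: 2 * b + j%:~R; 1 + 2 * a + d - e] 2
  = Gamma b * Gamma (1 - b)
      / (Gamma (b + j%:~R / 2 + `|j|%:~R / 2)
         * Gamma (1 - b - (floor_half (j + 1))%:~R))
    * csum (fun n =>
        Acoef j b n / n`!%:R
        * ((pochhammer a n * pochhammer (a + 1 / 2) n
            * pochhammer (b + (floor_half (j + 1))%:~R) n)
           / (pochhammer (b + j%:~R / 2) n
              * pochhammer (b + j%:~R / 2 + 1 / 2) n))
        * ((pochhammer (d / 2) n * pochhammer (d / 2 + 1 / 2) n)
           / (pochhammer (e / 2) n * pochhammer (e / 2 + 1 / 2) n)))
  + 2 * a / (2 * b + j%:~R) * (d / e)
    * (Gamma (- b) * Gamma (1 + b)
      / (Gamma (b + j%:~R / 2 + `|j|%:~R / 2)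
         * Gamma (- b - (floor_half j)%:~R)))
    * csum (fun n =>
        Bcoef j b n / n`!%:R
        * ((pochhammer (a + 1 / 2) n * pochhammer (a + 1) n
            * pochhammer (b + 1 + (floor_half j)%:~R) n)
           / (pochhammer (b + j%:~R / 2 + 1 / 2) n
              * pochhammer (b + j%:~R / 2 + 1) n))
        * ((pochhammer (d / 2 + 1 / 2) n * pochhammer (d / 2 + 1) n)
           / (pochhammer (e / 2 + 1 / 2) n * pochhammer (e / 2 + 1) n))).
Proof.
have hb : nonint b.
  move=> [n|n]; apply/eqP => bn.
    apply: (hGamma b); first by rewrite !inE eqxx ?orbT.
    by exists n; apply/eqP; rewrite -addr_eq0; apply/eqP.
  apply: (hGamma (1 - b)); first by rewrite !inE eqxx ?orbT.
  exists n; rewrite NegzE rmorphN /= in bn.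
  by rewrite (subr0_eq bn) -pmulrn -natr1; ring.
have hc : ~ nonposint (2 * b + j%:~R) by apply: hlow; rewrite !inE eqxx ?orbT.
have hf : ~ nonposint (1 + 2 * a + d - e).
  by apply: hlow; rewrite !inE eqxx ?orbT.
have hh : ~ nonposint (b + j%:~R / 2) by apply: hlow; rewrite !inE eqxx ?orbT.
have hh1 : ~ nonposint (b + j%:~R / 2 + 1 / 2).
  by apply: hlow; rewrite !inE eqxx ?orbT.
have hh2 : ~ nonposint (b + j%:~R / 2 + 1).
  by apply: hlow; rewrite !inE eqxx ?orbT.
have he0 : ~ nonposint (e / 2) by apply: hlow; rewrite !inE eqxx ?orbT.
have he1 : ~ nonposint (e / 2 + 1 / 2) by apply: hlow; rewrite !inE eqxx ?orbT.
have he2 : ~ nonposint (e / 2 + 1) by apply: hlow; rewrite !inE eqxx ?orbT.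
have he : ~ nonposint e by apply: hGamma; rewrite !inE eqxx ?orbT.
have hey : ~ nonposint (e - 2 * a - d).
  by apply: hGamma; rewrite !inE eqxx ?orbT.
have hG := gauss2_closed_Gamma hj hb hc hh hh1.
have [N w0 ->] := prefactor_sum b had hc he hf hey.
have fact0 n : (n`!%:R : R[i]) != 0 by rewrite pnatr_eq0 -lt0n fact_gt0.
have four0 n : (4 ^+ n : R[i]) != 0 by rewrite expf_neq0 // pnatr_eq0.
have half_nn : ~ nonposint (1 / 2 : R[i]).
  move=> [n hn]; have : 0 < (1 / 2 : R[i]) by rewrite mul1r invr_gt0.
  by rewrite hn oppr_gt0 ltrn0.
have d2 : 2 * (d / 2) = d by field.
have e2 : 2 * (e / 2) = e by field.
have e0 := nonposint_neq0 he; have c0 := nonposint_neq0 hc.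
rewrite (sum_even_odd (fun n => weight (2 * a) d e n
                                * gauss2 b (2 * b + j%:~R) n)).
rewrite -/(GammaA j b) -/(GammaB j b).
have leD n : (N <= n)%N -> (N <= n.*2)%N.
  by rewrite -addnn => /leq_trans-> //; rewrite leq_addr.
set u := (fun n => Acoef j b n / _ * _ * _).
set v := (fun n => Bcoef j b n / _ * _ * _).
set pB := 2 * a / _ * _ * _.
(* Duplication rewrites the symbols of [2a], [d], [e] and the factorial at half arguments; the
   powers of 4 cancel, and so does the symbol of [1 / 2] against the closed form. *)
have Eu m : GammaA j b * u m
    = weight (2 * a) d e m.*2 * gauss2 b (2 * b + j%:~R) m.*2.
  have [-> _] := hG m.
  rewrite /weight -{1}d2 -{1}e2 !pochhammer_double fact_double /u.
  have p0 := pochhammer_neq0 m hh; have p1 := pochhammer_neq0 m hh1.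
  have p2 := pochhammer_neq0 m he0; have p3 := pochhammer_neq0 m he1.
  have p4 := pochhammer_neq0 m half_nn.
  by field; rewrite p0 p1 p2 p3 p4 fact0 four0.
(* At odd index the first factors of the three symbols are left over as [2a * d / e], and
   [1 / (2b + j)] comes from the closed form: together with [GammaB j b] they make up [pB]. *)
have Ev m : pB * v m
    = weight (2 * a) d e m.*2.+1 * gauss2 b (2 * b + j%:~R) m.*2.+1.
  have [_ ->] := hG m.
  rewrite /weight -{1}d2 -{1}e2 !pochhammer_doubleS fact_doubleS /v /pB.
  have p0 := pochhammer_neq0 m hh2; have p1 := pochhammer_neq0 m hh1.
  have p2 := pochhammer_neq0 m he2; have p3 := pochhammer_neq0 m he1.
  have p4 : pochhammer (1 / 2 + 1 : R[i]) m != 0.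
    by apply: pochhammer_neq0; exact: (@nonposintD _ _ 1).
  rewrite -/(GammaB j b).
  by field; rewrite p0 p1 p2 p3 p4 fact0 four0 e0 c0.
congr (_ + _).
  rewrite (@mulr_csum_finite _ _ _ N); first by apply: eq_bigr => m _; rewrite Eu.
  by move=> k /leD/w0 wk; rewrite Eu wk mul0r.
rewrite (@mulr_csum_finite _ _ _ N); first by apply: eq_bigr => m _; rewrite Ev.
by move=> k /leD/leqW/w0 wk; rewrite Ev wk mul0r.
Qed.
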